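(* Let $c$ be a natural number and let $G,H$ be finite binary structures in the same signature such that (1) $\exists$ has a winning strategy in the colouring game ${\bf G}^{c+3}_\omega(G,H)$; (2) every partial homomorphism from $H$ to $H$ whose domain has size two extends to a homomorphism from $H$ to $H$; and (3) there are $i\neq i'\in G$ and $j,j'\in H$ such that $\{(i,j),(i',j')\}$ is a partial homomorphism from $G$ to $H$ that does not extend to a homomorphism $G\to H$. Then the class RRA of representable relation algebras cannot be defined by any $c$-variable first-order theory.
   Context: A binary structure is a structure whose signature consists only of binary relation symbols. A partial homomorphism from $G$ to $H$ is a partial map $h$ from $G$ to $H$ such that whenever $i\neq i'\in\mathrm{dom}(h)$ and $(i,i')\in b^G$ for a relation symbol $b$, then $(h(i),h(i'))\in b^H$; a homomorphism is a total such map. Colouring game ${\bf G}^{m}_\omega(G,H)$ (infinitely many rounds): a position is a pair $(g,h)$ of maps $g:\{0,\dots,m-1\}\to\mathcal P(G)$, $h:\{0,\dots,m-1\}\to\mathcal P(H)$, initially all empty. Each round $\forall$ chooses a colour $t<m$ and a subset of $G$ or of $H$, and $\exists$ chooses a subset of the other structure; $g(t),h(t)$ are replaced by these sets (erasing the previous use of colour $t$). For a palette $\pi\subseteq\{0,\dots,m-1\}$ let $\pi^g=\{x\in G:\forall t<m\,(x\in g(t)\iff t\in\pi)\}$ and similarly $\pi^h$. $\forall$ wins at $(g,h)$ if (C1) some palette $\pi$ has $\pi^g=\emptyset\neq\pi^h$ or $\pi^h=\emptyset\neq\pi^g$, or (C2) for some palettes $\pi,\pi'$ and relation symbol $b$,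 exactly one of $(\pi^g\times\pi'^g)\cap b^G$ and $(\pi^h\times\pi'^h)\cap b^H$ is empty. $\exists$ wins a play if no position in it is a win for $\forall$. A $c$-variable first-order theory is a set of first-order sentences in the language of relation algebras (operations $+,\cdot,-,0,1,;,{}^\smile,1'$) using only the variables $x_0,\dots,x_{c-1}$ (with arbitrary quantifier depth); RRA being defined by it means a relation algebra is representable iff it satisfies the theory. *)

(* Defs.v *)
From HB Require Import structures.
From mathcomp Require Import classical_sets.
From mathcomp Require Import all_boot all_order.

Set Implicit Arguments.
Unset Strict Implicit.
Unset Printing Implicit Defensive.

(* finset is imported after classical_sets: unqualified set0 is the empty
   finite set, and {set T} is a finite set, whereas set T is T -> Prop. *)

Record binary_structure (S : Type) := BinaryStructure {
  bs_carrier :> finType;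
  bs_interp : S -> {set bs_carrier * bs_carrier}
}.

Section PartialHomomorphisms.
Variables (S : Type) (G H : binary_structure S).
Implicit Types (h : G -> option H) (f : G -> H).

Definition pdom h : {set G} := [set i | isSome (h i)].

Definition partial_hom h : Prop :=
  forall (b : S) (i i' : G) (j j' : H), i != i' ->
    h i = Some j -> h i' = Some j' ->
    (i, i') \in bs_interp G b -> (j, j') \in bs_interp H b.

Definition homomorphism f : Prop := partial_hom (fun i => Some (f i)).

Definition extends_to_hom h : Prop :=
  exists2 f : G -> H, homomorphism f & forall i j, h i = Some j -> f i = j.

Definition pair_map (i : G) (j : H) (i' : G) (j' : H) : G -> option H :=
  fun x => if x == i then Some j else if x == i' then Some j' else None.

End PartialHomomorphisms.

Section ColouringGame.
Variables (S : Type) (m : nat) (G H : binary_structure S).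

Definition colouring (T : finType) := {ffun 'I_m -> {set T}}.

Definition recolour (T : finType) (g : colouring T) (t : 'I_m) (X : {set T}) :
  colouring T := [ffun s => if s == t then X else g s].

Definition palette_set (T : finType) (g : colouring T) (p : {set 'I_m}) :
  {set T} := [set x | [forall t, (x \in g t) == (t \in p)]].

Definition position := (colouring G * colouring H)%type.

Definition init_position : position := ([ffun=> set0], [ffun=> set0]).

Definition forall_wins_C1 (P : position) : Prop :=
  exists p : {set 'I_m},
    (palette_set P.1 p == set0) != (palette_set P.2 p == set0).

Definition forall_wins_C2 (P : position) : Prop :=
  exists (p p' : {set 'I_m}) (b : S),
    (setX (palette_set P.1 p) (palette_set P.1 p') :&: bs_interp G b == set0)
    != (setX (palette_set P.2 p) (palette_set P.2 p') :&: bs_interp H b == set0).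

Definition forall_wins (P : position) : Prop :=
  forall_wins_C1 P \/ forall_wins_C2 P.

(* A colour together with a subset of G (inl) or of H (inr). *)
Definition forall_move := ('I_m * ({set G} + {set H}))%type.

(* A strategy replies to the current move of the first player in view of the
   moves he made in all earlier rounds, oldest first; the earlier positions
   and replies are determined by these and by the strategy itself.  The first
   component replies to a subset of G, the second one to a subset of H. *)
Record strategy := Strategy {
  reply_in_H : seq forall_move -> 'I_m -> {set G} -> {set H};
  reply_in_G : seq forall_move -> 'I_m -> {set H} -> {set G}
}.

Definition next_position (s : strategy) (hist : seq forall_move)
    (a : forall_move) (P : position) : position :=
  match a with
  | (t, inl X) => (recolour P.1 t X, recolour P.2 t (reply_in_H s hist t X))
  | (t, inr Y) => (recolour P.1 t (reply_in_G s hist t Y), recolour P.2 t Y)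
  end.

Fixpoint play (s : strategy) (a : nat -> forall_move) (n : nat) : position :=
  if n is k.+1 then next_position s (mkseq a k) (a k) (play s a k)
  else init_position.

Definition winning_strategy (s : strategy) : Prop :=
  forall (a : nat -> forall_move) (n : nat), ~ forall_wins (play s a n).

Definition exists_wins_colouring_game : Prop :=
  exists s : strategy, winning_strategy s.

End ColouringGame.

HB.mixin Record isRelationAlgebra (d : Order.disp_t) T
    & Order.CTBDistrLattice d T := {
  ra_comp : T -> T -> T;
  ra_conv : T -> T;
  ra_id : T;
  ra_compA : forall a b c, ra_comp a (ra_comp b c) = ra_comp (ra_comp a b) c;
  ra_compUl : forall a b c,
    ra_comp (a `|` b)%O c = (ra_comp a c `|` ra_comp b c)%O;
  ra_comp1 : forall a, ra_comp a ra_id = a;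
  ra_convK : forall a, ra_conv (ra_conv a) = a;
  ra_convU : forall a b, ra_conv (a `|` b)%O = (ra_conv a `|` ra_conv b)%O;
  ra_conv_comp : forall a b,
    ra_conv (ra_comp a b) = ra_comp (ra_conv b) (ra_conv a);
  ra_tarski : forall a b,
    (ra_comp (ra_conv a) (~` (ra_comp a b)) <= ~` b)%O
}.

#[short(type="relationAlgebraType")]
HB.structure Definition RelationAlgebra (d : Order.disp_t) :=
  { T of Order.CTBDistrLattice d T & isRelationAlgebra d T }.

(* The unit of the representing algebra of relations, the image of 1, is only
   required to be an equivalence relation on U, not the full square. *)
Record representation (d : Order.disp_t) (A : relationAlgebraType d) (U : Type)
    (h : A -> set (U * U)) : Prop := Representation {
  rep_inj : injective h;
  rep_unit_refl : forall x, h \top%O (x, x);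
  rep_unit_sym : forall x y, h \top%O (x, y) -> h \top%O (y, x);
  rep_unit_trans : forall x y z,
    h \top%O (x, y) -> h \top%O (y, z) -> h \top%O (x, z);
  rep_join : forall a b, h (a `|` b)%O = (h a `|` h b)%classic;
  rep_meet : forall a b, h (a `&` b)%O = (h a `&` h b)%classic;
  rep_compl : forall a, h (~` a)%O = (h \top%O `\` h a)%classic;
  rep_bot : h \bot%O = classical_sets.set0;
  rep_comp : forall a b, h (ra_comp a b) =
    [set xy | exists z, h a (xy.1, z) /\ h b (z, xy.2)]%classic;
  rep_conv : forall a, h (ra_conv a) = [set xy | h a (xy.2, xy.1)]%classic;
  rep_id : h ra_id = diagonal
}.

Definition representable (d : Order.disp_t) (A : relationAlgebraType d) : Prop :=
  exists (U : Type) (h : A -> set (U * U)), representation h.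

Inductive ra_term (c : nat) : Type :=
| TVar of 'I_c
| TJoin of ra_term c & ra_term c
| TMeet of ra_term c & ra_term c
| TCompl of ra_term c
| TZero
| TOne
| TComp of ra_term c & ra_term c
| TConv of ra_term c
| TId.

Inductive ra_formula (c : nat) : Type :=
| FEq of ra_term c & ra_term c
| FFalse
| FNot of ra_formula c
| FAnd of ra_formula c & ra_formula c
| FOr of ra_formula c & ra_formula c
| FImp of ra_formula c & ra_formula c
| FForall of 'I_c & ra_formula c
| FExists of 'I_c & ra_formula c.

Fixpoint term_vars (c : nat) (u : ra_term c) : {set 'I_c} :=
  match u with
  | TVar i => [set i]
  | TJoin v w | TMeet v w | TComp v w => term_vars v :|: term_vars w
  | TCompl v | TConv v => term_vars v
  | TZero | TOne | TId => set0
  end.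

Fixpoint free_vars (c : nat) (F : ra_formula c) : {set 'I_c} :=
  match F with
  | FEq u v => term_vars u :|: term_vars v
  | FFalse => set0
  | FNot F1 => free_vars F1
  | FAnd F1 F2 | FOr F1 F2 | FImp F1 F2 => free_vars F1 :|: free_vars F2
  | FForall i F1 | FExists i F1 => free_vars F1 :\ i
  end.

Definition is_sentence (c : nat) (F : ra_formula c) : Prop :=
  free_vars F = set0.

Section Semantics.
Variables (c : nat) (d : Order.disp_t) (A : relationAlgebraType d).

Definition assignment := 'I_c -> A.

Definition update (e : assignment) (i : 'I_c) (a : A) : assignment :=
  fun k => if k == i then a else e k.

Fixpoint eval (e : assignment) (u : ra_term c) : A :=
  match u with
  | TVar i => e i
  | TJoin v w => (eval e v `|` eval e w)%O
  | TMeet v w => (eval e v `&` eval e w)%O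
  | TCompl v => (~` (eval e v))%O
  | TZero => \bot%O
  | TOne => \top%O
  | TComp v w => ra_comp (eval e v) (eval e w)
  | TConv v => ra_conv (eval e v)
  | TId => ra_id
  end.

Fixpoint holds (e : assignment) (F : ra_formula c) : Prop :=
  match F with
  | FEq u v => eval e u = eval e v
  | FFalse => False
  | FNot F1 => ~ holds e F1
  | FAnd F1 F2 => holds e F1 /\ holds e F2
  | FOr F1 F2 => holds e F1 \/ holds e F2
  | FImp F1 F2 => holds e F1 -> holds e F2
  | FForall i F1 => forall a : A, holds (update e i a) F1
  | FExists i F1 => exists a : A, holds (update e i a) F1
  end.

Definition satisfies (F : ra_formula c) : Prop :=
  forall e : assignment, holds e F.

End Semantics.

Definition theory (c : nat) := ra_formula c -> Prop.

Definition theory_of_sentences (c : nat) (Th : theory c) : Prop :=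
  forall F, Th F -> is_sentence F.

Definition models (c : nat) (d : Order.disp_t) (A : relationAlgebraType d)
    (Th : theory c) : Prop :=
  forall F, Th F -> satisfies A F.

Definition defines_RRA (c : nat) (Th : theory c) : Prop :=
  forall (d : Order.disp_t) (A : relationAlgebraType d),
    representable A <-> models A Th.

(* Main.v *)
(** For binary structures G and K let A(G,K) be the complex algebra of the
    symmetric atoms g_i (green, with tint i in G), white, yellow, black and
    pink, together with red atoms r_jj' (j, j' in K).  A triangle with two green
    edges must have a black third edge, or a pink one if the tints agree, or a
    red one r_jj' if they are i, i' and {(i,j),(i',j')} is a partial
    homomorphism; a triangle with one green and one yellow edge must have a
    white third edge; two yellow edges exclude yellow and black; and the indices
    of a red triangle must match.  So points z_i with (x,z_i) = g_i and
    (z_i,y) = yellow over a white edge (x,y) are joined by red edges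
    r_{f(i)f(k)} with f a homomorphism.

    In a representation every red edge r_jj' over two green edges g_i, g_i' lies
    over some white edge, which carries a point for every tint; hence A(G,K) is
    representable only if all partial homomorphisms of size two extend, and
    A(G,H) is not representable.  Conversely A(H,H) is represented step by step,
    using (2) to choose a homomorphism for each new white edge.

    Finally, c elements of A(G,H) or A(H,H) are coloured by their green parts,
    and membership of an atom in the value of a term is tested with two further
    colours used as pebbles, one for the atom and one for a green atom
    witnessing a composition; three are never needed, since no triangle is
    entirely green.  Hence a c-variable sentence cannot separate the two
    algebras. *)

From HB Require Import structures.
From mathcomp Require Import boolp classical_sets.
Require Import Defs.
From mathcomp Require Import all_boot all_order.

Set Implicit Arguments.
Unset Strict Implicit.
Unset Printing Implicit Defensive.

Import Order.DefaultSetSubsetOrder.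

(** * Atom structures and their complex algebras *)

(* [at_tri a b c]: there may be points with labels a on (x,y), b on (y,z) and
   c on (z,x). *)
Record atom_structure := AtomStructure {
  at_sort :> finType;
  at_id : at_sort;
  at_conv : at_sort -> at_sort;
  at_tri : at_sort -> at_sort -> at_sort -> bool;
  at_convK : involutive at_conv;
  at_conv_id : at_conv at_id = at_id;
  at_tri_rot : forall a b c, at_tri a b c = at_tri b c a;
  at_tri_conv : forall a b c,
    at_tri a b c = at_tri (at_conv c) (at_conv b) (at_conv a);
  at_tri_id : forall a b, at_tri a at_id b = (b == at_conv a);
  at_tri_amalg : forall a b c d e, at_tri a b e -> at_tri (at_conv e) c d ->
    exists2 f, at_tri b c f & at_tri a (at_conv f) d
}.

(** A separate name for [{set A}], because the relation algebra structure depends on the whole atom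
    structure and not only on its carrier. *)
Definition complex_algebra (A : atom_structure) := {set A}.

Section ComplexAlgebra.
Variable A : atom_structure.
Implicit Types (X Y Z : {set A}) (a b c : A).

Definition cm_comp X Y : {set A} :=
  [set c | [exists a in X, exists b in Y, at_tri a b (at_conv c)]].
Definition cm_conv X : {set A} := [set c | at_conv c \in X].

Lemma cm_compP X Y c :
  reflect (exists a b, [/\ a \in X, b \in Y & at_tri a b (at_conv c)])
          (c \in cm_comp X Y).
Proof.
rewrite inE; apply: (iffP exists_inP) => [[a aX /exists_inP[b bY t]]|].
  by exists a, b.
by case=> a [b [aX bY t]]; exists a => //; apply/exists_inP; exists b.
Qed.

(** Both inclusions are the amalgamation condition [at_tri_amalg]: a quadrilateral may be read from
    any of its sides, so one condition replaces either diagonal by the other. *)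
Lemma cm_compA X Y Z : cm_comp X (cm_comp Y Z) = cm_comp (cm_comp X Y) Z.
Proof.
apply/setP=> d; apply/cm_compP/cm_compP.
- case=> a [f [aX /cm_compP[b [c [bY cZ tf]]] ta]].
  have ta' : at_tri (at_conv (at_conv f)) (at_conv d) a.
    by rewrite at_convK -at_tri_rot.
  have [e t1 t2] := at_tri_amalg tf ta'.
  exists e, c; split=> //; last by rewrite at_tri_rot.
  by apply/cm_compP; exists a, b; split=> //; rewrite at_tri_rot.
- case=> e [c [/cm_compP[a [b [aX bY te]]] cZ tc]].
  rewrite -[e]at_convK in tc.
  have [f t1 t2] := at_tri_amalg te tc.
  exists a, (at_conv f); split=> //.
  by apply/cm_compP; exists b, c; split; rewrite ?at_convK.
Qed.

Lemma cm_compUl X Y Z : cm_comp (X :|: Y) Z = cm_comp X Z :|: cm_comp Y Z.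
Proof.
apply/setP=> c; rewrite in_setU; apply/cm_compP/orP.
- case=> a [b [/setUP[aX|aY] bZ t]]; [left|right]; apply/cm_compP;
    by exists a, b.
- by case=> /cm_compP[a [b [aX bZ t]]]; exists a, b; rewrite in_setU aX ?orbT.
Qed.

Lemma cm_comp1 X : cm_comp X [set at_id A] = X.
Proof.
apply/setP=> c; apply/cm_compP/idP => [[a [b [aX /set1P->]]]|cX].
  by rewrite at_tri_id (inj_eq (can_inj (@at_convK A))) => /eqP->.
by exists c, (at_id A); rewrite set11 at_tri_id eqxx.
Qed.

Lemma cm_convK X : cm_conv (cm_conv X) = X.
Proof. by apply/setP=> c; rewrite !inE at_convK. Qed.

Lemma cm_convU X Y : cm_conv (X :|: Y) = cm_conv X :|: cm_conv Y.
Proof. by apply/setP=> c; rewrite !inE. Qed.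

Lemma cm_conv_comp X Y : cm_conv (cm_comp X Y) = cm_comp (cm_conv Y) (cm_conv X).
Proof.
apply/setP=> c; rewrite inE; apply/cm_compP/cm_compP.
- case=> a [b [aX bY t]]; exists (at_conv b), (at_conv a).
  rewrite !inE !at_convK; split=> //.
  by rewrite at_tri_rot at_tri_rot -at_tri_conv -[c]at_convK.
- case=> b [a]; rewrite !inE => -[bY aX t].
  exists (at_conv a), (at_conv b); split=> //.
  by rewrite at_convK at_tri_rot at_tri_rot -[c]at_convK -at_tri_conv.
Qed.

(** The contrapositive is invariance of triangles under rotation and reversal. *)
Lemma cm_tarski X Y : cm_comp (cm_conv X) (~: cm_comp X Y) \subset ~: Y.
Proof.
apply/subsetP=> c /cm_compP[a [b [aX]]]; rewrite !inE in aX * => bXY t.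
apply: contra bXY => cY; apply/exists_inP; exists (at_conv a) => //.
apply/exists_inP; exists c => //.
by rewrite at_tri_conv !at_convK at_tri_rot at_tri_rot.
Qed.

End ComplexAlgebra.

HB.instance Definition _ (A : atom_structure) :=
  Order.CTBDistrLattice.on (complex_algebra A).
HB.instance Definition _ (A : atom_structure) :=
  isRelationAlgebra.Build _ (complex_algebra A)
    (@cm_compA A) (@cm_compUl A) (@cm_comp1 A) (@cm_convK A) (@cm_convU A)
    (@cm_conv_comp A) (@cm_tarski A).

(** * Rainbow algebras *)

Inductive shade (J : Type) := Id | White | Yellow | Black | Pink | Red of J & J.
Arguments Id {J}.
Arguments White {J}.
Arguments Yellow {J}.
Arguments Black {J}.
Arguments Pink {J}.

Definition shade_code (J : Type) (s : shade J) :
    option (option (option (option (option (J * J))))) :=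
  match s with
  | Id => None
  | White => Some None
  | Yellow => Some (Some None)
  | Black => Some (Some (Some None))
  | Pink => Some (Some (Some (Some None)))
  | Red j k => Some (Some (Some (Some (Some (j, k)))))
  end.

Definition shade_decode (J : Type) s : shade J :=
  match s with
  | None => Id
  | Some None => White
  | Some (Some None) => Yellow
  | Some (Some (Some None)) => Black
  | Some (Some (Some (Some None))) => Pink
  | Some (Some (Some (Some (Some (j, k))))) => Red j k
  end.

Lemma shade_codeK (J : Type) : cancel (@shade_code J) (@shade_decode J).
Proof. by case. Qed.

HB.instance Definition _ (J : finType) :=
  Finite.copy (shade J) (can_type (@shade_codeK J)).

(* [fr_edge i i' j j'] stands for {(i,j),(i',j')} being a partial homomorphism. *)
Record frame := Frame {
  fr_tint : finType;
  fr_index : finType;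
  fr_edge : fr_tint -> fr_tint -> fr_index -> fr_index -> bool;
  fr_edgeC : forall i i' j j', fr_edge i i' j j' = fr_edge i' i j' j;
  fr_edge_irr : forall i j j', ~~ fr_edge i i j j';
  fr_edge_total : forall i i', i != i' -> exists j j', fr_edge i i' j j'
}.

Section Rainbow.
Variable F : frame.
Local Notation I := (fr_tint F).
Local Notation J := (fr_index F).

(** The green atom of tint [i] is [inl i]. The other atoms depend on the index type alone, so two
    frames with the same indices share them. *)
Definition ratom := (I + shade J)%type.
HB.instance Definition _ := Finite.on ratom.
Implicit Types a b c d e f u v : ratom.

Definition rconv a : ratom :=
  if a is inr (Red j k) then inr (Red k j) else a.

Definition rid_check a b c : bool := (a == inr Id) ==> (b == rconv c).

(* The constraint which labels a on (x,y) and b on (y,z), both diversity atoms,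
   put on the label c of (z,x). *)
Definition rcheck a b c : bool :=
  match a, b, c with
  | inr Id, _, _ | _, inr Id, _ | _, _, inr Id => true
  | inl _, inl _, inr Black => true
  | inl i, inl k, inr Pink => i == k
  | inl i, inl k, inr (Red j j') => fr_edge k i j j'
  | inl _, inl _, _ => false
  | inl _, inr Yellow, inr White | inr Yellow, inl _, inr White => true
  | inl _, inr Yellow, _ | inr Yellow, inl _, _ => false
  | inr Yellow, inr Yellow, inr (Yellow | Black) => false
  | inr (Red _ k), inr (Red k' _), inr (Red _ _) => k == k'
  | _, _, _ => true
  end.

(** Imposing the checks on all three rotations makes [rtri] invariant under rotation, although
    [rcheck] looks at one corner only. *)
Definition rtri a b c :=
  [&& rid_check a b c, rid_check b c a, rid_check c a b,
      rcheck a b c, rcheck b c a & rcheck c a b].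

Lemma rconvK : involutive rconv.
Proof. by case=> [i|[]]. Qed.

Lemma rconv_eq a b : (rconv a == b) = (a == rconv b).
Proof. exact: can2_eq rconvK rconvK _ _. Qed.

Lemma rconv_Id a : (rconv a == inr Id) = (a == inr Id).
Proof. exact: rconv_eq. Qed.

Lemma rid_check_conv a b c :
  rid_check a b c = rid_check (rconv a) (rconv c) (rconv b).
Proof. by rewrite /rid_check rconv_Id rconvK; congr (_ ==> _); apply: eq_sym. Qed.

Lemma rcheck_conv a b c : rcheck a b c = rcheck (rconv b) (rconv a) (rconv c).
Proof.
case: a => [i|[|||||j1 k1]]; case: b => [i'|[|||||j2 k2]];
  case: c => [i''|[|||||j3 k3]] //=; rewrite 1?fr_edgeC 1?eq_sym //.
Qed.

Lemma rtri_rot a b c : rtri a b c = rtri b c a.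
Proof.
rewrite /rtri.
move: (rid_check a b c) (rid_check b c a) (rid_check c a b).
move: (rcheck a b c) (rcheck b c a) (rcheck c a b).
by do 6 case.
Qed.

Lemma rtri_conv a b c : rtri a b c = rtri (rconv c) (rconv b) (rconv a).
Proof.
rewrite /rtri -!rid_check_conv -!rcheck_conv.
move: (rid_check a b c) (rid_check b c a) (rid_check c a b).
move: (rcheck a b c) (rcheck b c a) (rcheck c a b).
by do 6 case.
Qed.

Lemma rcheck_Id a b c :
  [|| a == inr Id, b == inr Id | c == inr Id] -> rcheck a b c.
Proof.
by case/or3P=> /eqP->; case: a b c => [?|[|||||? ?]] [?|[|||||? ?]] [?|[|||||? ?]].
Qed.

Lemma rtri_id a b : rtri a (inr Id) b = (b == rconv a).
Proof.
rewrite /rtri !rcheck_Id ?eqxx ?orbT // !andbT /rid_check eqxx /=.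
apply/and3P/idP => [[_ //]|/eqP->]; rewrite eqxx rconvK rconv_Id.
by rewrite [inr Id == a]eq_sym; split=> //; apply: implybb.
Qed.

Definition isg a := if a is inl _ then true else false.
Definition isy a := if a is inr Yellow then true else false.

Lemma isg_isy a : isg a -> isy a = false.
Proof. by case: a. Qed.

Definition div a := a != inr Id.

Lemma rtri_div a b c : div a -> div b -> div c ->
  rtri a b c = [&& rcheck a b c, rcheck b c a & rcheck c a b].
Proof.
by rewrite /div /rtri /rid_check => /negPf-> /negPf-> /negPf->.
Qed.

Lemma rtri_white a b : div a -> div b -> ~~ (isg a && isg b) ->
  rtri a b (inr White).
Proof.
move=> da db; rewrite rtri_div //.
by move: da db; case: a b => [?|[|||||? ?]] [?|[|||||? ?]].
Qed.

Lemma rtri_black a b : div a -> div b -> ~~ (isy a && isy b) ->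
  ~~ (isg a && isy b) -> ~~ (isy a && isg b) -> rtri a b (inr Black).
Proof.
move=> da db; rewrite rtri_div //.
by move: da db; case: a b => [?|[|||||? ?]] [?|[|||||? ?]].
Qed.

Lemma rtri_gg i k r : div (inr r) -> rtri (inl i) (inl k) (inr r) =
  match r with Black => true | Pink => i == k | Red j j' => fr_edge k i j j'
             | _ => false end.
Proof. by move=> dr; rewrite rtri_div //; case: r dr => //= *; rewrite andbT. Qed.

Lemma rtri_gy i c : div c -> rtri (inl i) (inr Yellow) c = (c == inr White).
Proof. by move=> dc; rewrite rtri_div //; case: c dc => [?|[|||||? ?]]. Qed.

Lemma rtri_yg i c : div c -> rtri (inr Yellow) (inl i) c = (c == inr White).
Proof. by move=> dc; rewrite rtri_div //; case: c dc => [?|[|||||? ?]]. Qed.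

Lemma rtri_ggg i k l : rtri (inl i) (inl k) (inl l) = false.
Proof. by rewrite rtri_div. Qed.

Lemma rtri_yy c : div c ->
  rtri (inr Yellow) (inr Yellow) c =
  (if c is inr (White | Pink | Red _ _) then true else false).
Proof. by move=> dc; rewrite rtri_div //; case: c dc => [?|[|||||? ?]]. Qed.

Lemma rtri_Id2 a b : rtri (inr Id) a b = (a == rconv b).
Proof. by rewrite -rtri_rot rtri_id. Qed.

Lemma rtri_Id3 a b : rtri a b (inr Id) = (a == rconv b).
Proof. by rewrite rtri_rot rtri_id. Qed.

(** Distinct tints exclude pink and the two yellow edges exclude black, so only red is left. *)
Lemma rtri_cone i k c : i != k -> rtri (inl i) (inl k) c ->
  rtri (inr Yellow) (inr Yellow) c ->
  exists j j', c = inr (Red j' j) /\ fr_edge i k j j'.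
Proof.
move=> ik; have [->|dc] := eqVneq c (inr Id).
  by rewrite rtri_Id3 => /eqP [eik]; rewrite eik eqxx in ik.
case: c dc => [l|r] dr; first by rewrite rtri_ggg.
rewrite rtri_gg // rtri_yy //; case: r dr => // [_|j' j _ e _].
  by rewrite (negPf ik).
by exists j, j'; rewrite fr_edgeC.
Qed.

(** A green and a yellow edge force the diagonal [e] to be white, and two green edges forbid a white
    one. So two opposite corners of a quadrilateral cannot be green-green and green-yellow. *)
Lemma rtri_gy_gg a b c d e :
  rtri a b e -> rtri (rconv e) c d -> isg b && isg c ->
  ~~ (isg d && isy a) && ~~ (isy d && isg a).
Proof.
case: b c => [i|?] [k|?] //; case: d a => [?|[|||||? ?]] [?|[|||||? ?]] // t1 t2 _.
- have [e1|de] := eqVneq e (inr Id); first by rewrite e1 rtri_Id3 in t1.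
  by move: t1 t2; rewrite rtri_yg // => /eqP->; rewrite -rtri_rot.
- have [e1|de] := eqVneq e (inr Id); first by rewrite e1 rtri_Id2 in t2.
  move: t2; rewrite rtri_rot rtri_gy ?/div ?rconv_Id // rconv_eq => /eqP e1.
  by rewrite e1 rtri_gg in t1.
Qed.

(** White is a possible second diagonal unless one of its two corners is green-green. Then black is
    possible unless the opposite corner is yellow-yellow, as [rtri_gy_gg] rules out a green-yellow
    one. In the last case pink serves for equal tints and, by [fr_edge_total], some red atom for
    distinct ones. *)
Lemma rtri_amalg a b c d e : rtri a b e -> rtri (rconv e) c d ->
  exists2 f, rtri b c f & rtri a (rconv f) d.
Proof.
move=> t1 t2.
have [a1|da] := eqVneq a (inr Id).
  move: t1; rewrite a1 rtri_Id2 => /eqP eb; exists d; first by rewrite eb.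
  by rewrite rtri_Id2.
have [b1|db] := eqVneq b (inr Id).
  move: t1; rewrite b1 rtri_id => /eqP ea; rewrite ea rconvK in t2.
  by exists (rconv c); rewrite ?rconvK // rtri_Id2 rconvK.
have [c1|dc] := eqVneq c (inr Id).
  move: t2; rewrite c1 rtri_id rconvK => /eqP->.
  by exists (rconv b); rewrite ?rconvK // rtri_id.
have [d1|dd] := eqVneq d (inr Id).
  move: t2; rewrite d1 rtri_Id3 (inj_eq (can_inj rconvK)) => /eqP<-.
  exists a; first by rewrite -rtri_rot.
  by rewrite rtri_Id3 rconvK.
suff [f t3 t4] : exists2 f, rtri b c f & rtri d a (rconv f).
  by exists f; rewrite // -rtri_rot.
have [gbc|gbc] := boolP (isg b && isg c).
  have /andP[n1 n2] := rtri_gy_gg t1 t2 gbc.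
  have [yda|yda] := boolP (isy d && isy a); last first.
    case/andP: gbc => gb gc; exists (inr Black); apply: rtri_black => //;
      by rewrite ?(isg_isy gb) ?(isg_isy gc) ?andbF.
  case: b c d a gbc yda db dc da dd {t1 t2 n1 n2}
    => [i|?] [k|?] [?|[|||||? ?]] [?|[|||||? ?]] // _ _ _ _ _ _.
  have [->|ki] := eqVneq i k; first by exists (inr Pink); rewrite ?rtri_gg ?rtri_yy.
  have [j [j' ejj]] := fr_edge_total ki.
  by exists (inr (Red j' j)); rewrite ?rtri_gg ?rtri_yy // fr_edgeC.
have [gda|gda] := boolP (isg d && isg a); last first.
  by exists (inr White); apply: rtri_white.
have /andP[n1 n2] : ~~ (isg b && isy c) && ~~ (isy b && isg c).
  apply: (@rtri_gy_gg c d a b (rconv e)) gda; first by rewrite -rtri_rot.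
  by rewrite rconvK rtri_rot.
have [ybc|ybc] := boolP (isy b && isy c); last first.
  case/andP: gda => gd ga; exists (inr Black); apply: rtri_black => //;
    by rewrite ?(isg_isy gd) ?(isg_isy ga) ?andbF.
case: d a b c gda ybc db dc da dd {t1 t2 gbc n1 n2}
  => [i|?] [k|?] [?|[|||||? ?]] [?|[|||||? ?]] // _ _ _ _ _ _.
have [->|ki] := eqVneq i k; first by exists (inr Pink); rewrite ?rtri_gg ?rtri_yy.
have [j [j' ejj]] := fr_edge_total ki.
by exists (inr (Red j j')); rewrite ?rtri_gg ?rtri_yy // fr_edgeC.
Qed.

Definition rainbow : atom_structure :=
  AtomStructure rconvK (erefl : rconv (inr Id) = inr Id) rtri_rot rtri_conv
    rtri_id rtri_amalg.

End Rainbow.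

(** * Representations from networks *)

Section Networks.
Variable A : atom_structure.
Implicit Types (L M : nat -> nat -> A) (al be : A).

(** The labelling is defined on all of [nat] but only points below [n] count, so that adding a point
    changes no type. *)
Record network n L : Prop := Network {
  net_id : forall x y, x < n -> y < n -> (L x y == at_id A) = (x == y);
  net_conv : forall x y, x < n -> y < n -> L y x = at_conv (L x y);
  net_tri : forall x y z, x < n -> y < n -> z < n ->
    at_tri (L x y) (L y z) (L z x)
}.

Lemma tri_at_id2 al be : at_tri (at_id A) al be = (be == at_conv al).
Proof.
rewrite -at_tri_rot at_tri_id.
by rewrite -[RHS](inj_eq (can_inj (@at_convK A))) at_convK eq_sym.
Qed.

Definition extend n L (N : nat -> A) x y : A :=
  if x == n then (if y == n then at_id A else N y)
  else if y == n then at_conv (N x) else L x y.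

Lemma extendn n L N y : y < n -> extend n L N n y = N y.
Proof. by rewrite /extend eqxx => /ltn_eqF->. Qed.

Lemma extendC n L N x : x < n -> extend n L N x n = at_conv (N x).
Proof. by rewrite /extend eqxx => /ltn_eqF->. Qed.

Lemma extend_lt n L N x y : x < n -> y < n -> extend n L N x y = L x y.
Proof. by rewrite /extend => /ltn_eqF-> /ltn_eqF->. Qed.

Lemma extendnn n L N : extend n L N n n = at_id A.
Proof. by rewrite /extend eqxx. Qed.

(** Here [N c] labels the edge from the new point [n] to [c]. Triangles with a repeated point hold
    automatically, and the remaining new ones are rotations of those in the last hypothesis. *)
Lemma network_extend n L N : network n L ->
  (forall c, c < n -> N c != at_id A) ->
  (forall c c', c < n -> c' < n -> c != c' ->
     at_tri (N c) (L c c') (at_conv (N c'))) ->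
  network n.+1 (extend n L N).
Proof.
move=> net Ndiv Ntri.
have Ntri' c c' : c < n -> c' < n -> at_tri (N c) (L c c') (at_conv (N c')).
  move=> cn c'n; have [<-|ne] := eqVneq c c'; last exact: Ntri.
  by rewrite (eqP (_ : L c c == at_id A)) ?at_tri_id // (net_id net) ?eqxx.
have split x : x < n.+1 -> x = n \/ x < n.
  by rewrite ltnS leq_eqVlt => /orP[/eqP|]; [left|right].
have conv_eq_id al : (at_conv al == at_id A) = (al == at_id A).
  by rewrite -(inj_eq (can_inj (@at_convK A))) at_convK at_conv_id.
split=> x y.
- move=> /split[->|xn] /split[->|yn].
  + by rewrite extendnn !eqxx.
  + by rewrite extendn // (negPf (Ndiv _ yn)) gtn_eqF.
  + by rewrite extendC // conv_eq_id (negPf (Ndiv _ xn)) ltn_eqF.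
  + by rewrite extend_lt // (net_id net).
- move=> /split[->|xn] /split[->|yn].
  + by rewrite extendnn at_conv_id.
  + by rewrite extendn ?extendC.
  + by rewrite extendn ?extendC // at_convK.
  + by rewrite !extend_lt // (net_conv net).
- move=> z /split[->|xn] /split[->|yn] /split[->|zn];
    rewrite ?extendnn ?(extendn, extendC) ?extend_lt //.
  + by rewrite at_tri_id at_conv_id.
  + by rewrite tri_at_id2.
  + by rewrite at_tri_rot at_tri_id at_convK.
  + exact: Ntri'.
  + by rewrite at_tri_id at_convK.
  + by rewrite at_tri_rot; apply: Ntri'.
  + by rewrite -at_tri_rot; apply: Ntri'.
  + exact: (net_tri net).
Qed.

(** A set of atoms is represented by the pairs of naturals whose label lies in it; saturation makes
    the image of a composition large enough. *)
Lemma representable_network L :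
  (forall n, network n L) ->
  (forall x y al be, al != at_id A -> be != at_id A -> at_tri al be (L y x) ->
     exists2 z, L x z = al & L z y = be) ->
  representable (complex_algebra A : relationAlgebraType _).
Proof.
move=> net sat.
have Lid x y : (L x y == at_id A) = (x == y).
  by apply: (net_id (net (maxn x y).+1)); rewrite ltnS ?leq_maxl ?leq_maxr.
have Lconv x y : L y x = at_conv (L x y).
  by apply: (net_conv (net (maxn x y).+1)); rewrite ltnS ?leq_maxl ?leq_maxr.
have Ltri x y z : at_tri (L x y) (L y z) (L z x).
  by apply: (net_tri (net (maxn x (maxn y z)).+1));
    rewrite ltnS !leq_max leqnn ?orbT.
have Lxx x : L x x = at_id A by apply/eqP; rewrite Lid.
(* If one of the two labels is the identity, an endpoint is the witness. *)
have sat' x y al be : at_tri al be (L y x) -> exists2 z, L x z = al & L z y = be.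
  have [->|dal] := eqVneq al (at_id A).
    rewrite tri_at_id2 (Lconv x y) (inj_eq (can_inj (@at_convK A))) => /eqP<-.
    by exists x.
  have [->|dbe] := eqVneq be (at_id A); last exact: sat.
  by rewrite at_tri_id (Lconv x y) (inj_eq (can_inj (@at_convK A))) => /eqP<-; exists y.
exists nat, (fun (X : {set A}) (xy : nat * nat) => L xy.1 xy.2 \in X).
split=> //=.
- move=> X Y eXY; apply/setP=> al.
  (* The triangle on [al], its converse and the loop at 0 shows that every atom labels some edge
     leaving 0, which gives injectivity. *)
  have [|z <- _] := @sat' 0 0 al (at_conv al).
    by rewrite Lxx -at_tri_rot tri_at_id2 eqxx.
  have /= e : is_true (_ \in _) = is_true (_ \in _) := congr1 (@^~ (0, z)) eXY.
  by apply/idP/idP; rewrite e.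
- move=> X Y; apply/funext=> xy; apply/propext.
  by split=> [/setUP|?]; last apply/setUP.
- move=> X Y; apply/funext=> xy; apply/propext.
  by split=> [/setIP|?]; last apply/setIP.
- move=> X; apply/funext=> xy; apply/propext; split=> [|[_ /negP nX]].
    by move/setCP=> nX; split=> //; apply: in_setT.
  exact/setCP/negP.
- by apply/funext=> xy; apply/propext; split=> //; rewrite in_set0.
- move=> X Y; apply/funext=> -[x y]; apply/propext; split=> /=.
    case/cm_compP=> al [be [alX beY]]; rewrite -Lconv => /sat'[z e1 e2].
    by exists z; rewrite /= e1 e2.
  case=> z [/= zX zY]; apply/cm_compP; exists (L x z), (L z y); split=> //.
  by rewrite -Lconv.
- move=> X; apply/funext=> -[x y]; apply/propext.
  by rewrite /= (Lconv x y); split=> [|?]; rewrite in_set.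
- apply/funext=> -[x y]; apply/propext; split=> /=.
    by move=> /set1P/eqP; rewrite Lid => /eqP.
  by rewrite /diagonal /= => ->; rewrite Lxx set11.
Qed.

End Networks.

(** * Step by step construction of a saturated labelling *)

Section Limit.
Variable A : atom_structure.
Implicit Types (L M : nat -> nat -> A).

Definition task := (nat * nat * A * A)%type.

(** Here [L] is the labelling after the point [n] has been added, hence the bound [n.+1] on the
    witness. *)
Definition task_done n L (T : task) :=
  let: (x, y, al, be) := T in
  x < n -> y < n -> al != at_id A -> be != at_id A -> at_tri al be (L y x) ->
  exists2 z, z < n.+1 & L x z = al /\ L z y = be.

(** A task may come up before its points exist, so it has to recur for ever. It is paired with a
    counter: otherwise [n.+1] distinct codes would all lie below [n]. *)
Lemma task_recurs (T : task) n :
  exists2 k, n <= k & exists m, unpickle k = Some (m : nat, T).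
Proof.
have [/existsP[m le_nm]|/existsPn noT] :=
    boolP [exists m : 'I_n.+1, n <= pickle (m : nat, T)].
  by exists (pickle (m : nat, T)) => //; exists m; rewrite pickleK.
have lt_n (m : 'I_n.+1) : pickle (m : nat, T) < n by rewrite ltnNge noT.
suff /leq_card : injective (fun m => Ordinal (lt_n m)).
  by rewrite !card_ord ltnn.
move=> m m' [] /(pcan_inj (@pickleK _)) [eqm]; exact: val_inj.
Qed.

(** [N] is any invariant, stronger than being a network, under which each task can be met by adding
    one point. The union of the resulting chain is saturated. *)
Lemma representable_limit (N : nat -> (nat -> nat -> A) -> Prop) L1 :
  (forall n L, N n L -> network n L) -> N 1 L1 ->
  (forall n L T, 0 < n -> N n L -> exists L',
     [/\ N n.+1 L', forall x y, x < n -> y < n -> L' x y = L x y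
       & task_done n L' T]) ->
  representable (complex_algebra A : relationAlgebraType _).
Proof.
move=> netN N1 step.
pose T0 : task := (0, 0, at_id A, at_id A).
pose tsk k : task :=
  if (unpickle k : option (nat * task)) is Some (_, T) then T else T0.
have [F F0 FS] : exists2 F : nat -> nat -> nat -> A, N 1 (F 0) &
    forall k, N k.+1 (F k) ->
    [/\ N k.+2 (F k.+1), forall x y, x < k.+1 -> y < k.+1 -> F k.+1 x y = F k x y
      & task_done k.+1 (F k.+1) (tsk k)].
  (* The step is made total on pairs of a size and a labelling, so that plain choice followed by
     recursion is enough. *)
  have step' (p : nat * (nat -> nat -> A)) : exists L', N p.1.+1 p.2 ->
    [/\ N p.1.+2 L', forall x y, x < p.1.+1 -> y < p.1.+1 -> L' x y = p.2 x y
      & task_done p.1.+1 L' (tsk p.1)].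
    have [Np|nNp] := EM (N p.1.+1 p.2); last by exists p.2 => /nNp.
    by have [L' ?] := step _ _ (tsk p.1) (ltn0Sn p.1) Np; exists L'.
  have [f fP] := choice step'.
  exists (nat_rect (fun=> nat -> nat -> A) L1 (fun k L => f (k, L))) => // k.
  exact: fP (k, _).
have FN k : N k.+1 (F k) by elim: k => // k /FS[].
have Fagree k l x y : k <= l -> x <= k -> y <= k -> F l x y = F k x y.
  move=> kl xk yk; elim: l kl => [|l IH]; first by rewrite leqn0 => /eqP->.
  rewrite leq_eqVlt => /orP[/eqP->//|]; rewrite ltnS => kl.
  have [_ agree _] := FS _ (FN l).
  by rewrite agree ?IH // ltnS ?(leq_trans xk) ?(leq_trans yk).
(* Stage [k] has the points 0 to [k], so stage [maxn x y] is the first one containing both points,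
   and later stages agree with it. *)
pose M x y := F (maxn x y) x y.
have ME k x y : x <= k -> y <= k -> M x y = F k x y.
  by move=> xk yk; rewrite (@Fagree (maxn x y)) ?geq_max ?xk ?leq_maxl ?leq_maxr.
apply: (@representable_network _ M).
- move=> n; have [Fid Fconv Ftri] := netN _ _ (FN n).
  split=> x y.
  + by move=> /ltnW xn /ltnW yn; rewrite (@ME n) //; apply: Fid.
  + by move=> /ltnW xn /ltnW yn; rewrite !(@ME n) //; apply: Fconv.
  + by move=> z /ltnW xn /ltnW yn /ltnW zn; rewrite !(@ME n) //; apply: Ftri.
- move=> x y al be dal dbe t.
  have [k le_k [m km]] := task_recurs (x, y, al, be) (maxn x y).
  move: le_k; rewrite geq_max => /andP[xk yk].
  have [_ _] := FS _ (FN k); rewrite /tsk km => /(_ xk yk dal dbe).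
  case=> [|z zk [e1 e2]]; first by rewrite -ME // leqW.
  by exists z; rewrite (@ME k.+1) // leqW.
Qed.

End Limit.

(** * Representing a rainbow algebra whose partial homomorphisms of size two extend *)

Section RainbowRepresentation.
Variable F : frame.
Local Notation I := (fr_tint F).
Local Notation J := (fr_index F).
Implicit Types (L : nat -> nat -> ratom F) (al be u v w : ratom F).

Definition fr_hom (f : I -> J) :=
  forall i i', i != i' -> fr_edge i i' (f i) (f i').

Hypothesis hom_exists : exists f, fr_hom f.
Hypothesis hom_extends : forall i i' j j', fr_edge i i' j j' ->
  exists2 f, fr_hom f & f i = j /\ f i' = j'.

Definition isr u := if u is inr (Red _ _) then true else false.

Definition soft u :=
  if u is inr (White | Black | Pink | Red _ _) then true else false.

Lemma isgP u : isg u -> exists i, u = inl i.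
Proof. by case: u => // i; exists i. Qed.

Lemma isyP u : isy u -> u = inr Yellow.
Proof. by case: u => [|[]]. Qed.

Lemma isg_conv u : isg (rconv u) = isg u.
Proof. by case: u => [?|[]]. Qed.

Lemma isy_conv u : isy (rconv u) = isy u.
Proof. by case: u => [?|[]]. Qed.

Lemma soft_conv u : soft (rconv u) = soft u.
Proof. by case: u => [?|[]]. Qed.

Lemma isr_conv u : isr (rconv u) = isr u.
Proof. by case: u => [?|[]]. Qed.

Lemma div_conv u : div (rconv u) = div u.
Proof. by rewrite /div rconv_Id. Qed.

Lemma soft_div u : soft u -> div u.
Proof. by case: u => [?|[]]. Qed.

(** A forbidden triangle of diversity atoms that is not entirely red has at least two edges that are
    green or yellow. *)
Lemma rtri_soft u v w : soft u -> soft w -> div v ->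
  ~~ [&& isr u, isr v & isr w] -> rtri u v w.
Proof.
move=> su sw dv; rewrite rtri_div ?(soft_div su) ?(soft_div sw) //.
by move: su sw dv; case: u v w => [?|[|||||? ?]] [?|[|||||? ?]] [?|[|||||? ?]].
Qed.

Definition in_cone L x y c i := L x c = inl i /\ L c y = inr Yellow.

(* The points over the edge (x,y) form a red clique, indexed by a homomorphism. *)
Definition cone_hom n L x y := exists2 f, fr_hom f &
  forall c c' i i', c < n -> c' < n -> i != i' ->
    in_cone L x y c i -> in_cone L x y c' i' ->
    L c c' = inr (Red (f i) (f i')).

(** By [rtri_gy], only white edges can have points over them. *)
Definition rnetwork n L := @network (rainbow F) n L /\
  forall x y, x < n -> y < n -> L x y = inr White -> cone_hom n L x y.

(** If two points of different tints lie over [(x,y)], their edge is red by [rtri_cone], and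
    [hom_extends] supplies a homomorphism through its indices. Otherwise any homomorphism will do.
    This applies to each new white edge. *)
Lemma cone_hom2 n L a d x y : @network (rainbow F) n L -> a < n -> d < n ->
  x < n -> y < n ->
  (forall c i, c < n -> in_cone L x y c i -> c = a \/ c = d) ->
  cone_hom n L x y.
Proof.
move=> net an dn xn yn ad.
have Lconv p q : p < n -> q < n -> L q p = rconv (L p q).
  by move=> pn qn; apply: (net_conv net).
have [[i [k [ik [ca cd]]]]|none] :=
    EM (exists i k, i != k /\ (in_cone L x y a i /\ in_cone L x y d k)); last first.
  have [f fhom] := hom_exists; exists f => // c c' i i' cn c'n ii' ci ci'.
  have eq_tint p : in_cone L x y p i -> in_cone L x y p i' -> i = i'.
    by move=> [e1 _] [e2 _]; move: e1; rewrite e2 => -[].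
  have [ea|ed] := ad _ _ cn ci; have [ea'|ed'] := ad _ _ c'n ci'; subst.
  - by rewrite (eq_tint a) ?eqxx in ii'.
  - by case: none; exists i, i'.
  - by case: none; exists i', i; rewrite eq_sym.
  - by rewrite (eq_tint d) ?eqxx in ii'.
have [j [j' [Lda ekij]]] : exists j j', L d a = inr (Red j' j) /\ fr_edge i k j j'.
  have t1 : rtri (L a x) (L x d) (L d a) by apply: (net_tri net).
  have t2 : rtri (L a y) (L y d) (L d a) by apply: (net_tri net).
  move: ca cd t1 t2 => [xa ya] [xd yd].
  by rewrite (Lconv x a) // xa xd ya (Lconv d y) // yd; apply: rtri_cone.
have Lad : L a d = inr (Red j j') by rewrite (Lconv d a) // Lda.
have [f fhom [fi fk]] := hom_extends ekij; exists f => // c c' i1 i2 cn c'n i12 c1 c2.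
have tint p i0 k0 : in_cone L x y p i0 -> in_cone L x y p k0 -> i0 = k0.
  by move=> [e1 _] [e2 _]; move: e1; rewrite e2 => -[].
have [ea|ed] := ad _ _ cn c1; have [ea'|ed'] := ad _ _ c'n c2;
  rewrite ?ea ?ed ?ea' ?ed'.
- by rewrite ea in c1; rewrite ea' in c2; rewrite (tint _ _ _ c1 c2) eqxx in i12.
- rewrite ea in c1; rewrite ed' in c2.
  by rewrite -(tint _ _ _ ca c1) -(tint _ _ _ cd c2) fi fk.
- rewrite ed in c1; rewrite ea' in c2.
  by rewrite -(tint _ _ _ cd c1) -(tint _ _ _ ca c2) fi fk.
- by rewrite ed in c1; rewrite ed' in c2; rewrite (tint _ _ _ c1 c2) eqxx in i12.
Qed.

(** Excluding [al] yellow with [be] green ensures that [(a,d)] is the only old edge over which the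
    new point can lie. The homomorphism of that cone then dictates the new red labels. *)
Lemma rnetwork_point n L a d al be : a < n -> d < n -> div al -> div be ->
  rtri al be (L d a) -> ~~ (isy al && isg be) -> rnetwork n L ->
  exists L', [/\ rnetwork n.+1 L', forall x y, x < n -> y < n -> L' x y = L x y
    & L' a n = al /\ L' n d = be].
Proof.
move=> an dn dal dbe tab nyg [net cones].
have Lid x y : x < n -> y < n -> (L x y == inr Id) = (x == y).
  by move=> xn yn; apply: (net_id net).
have Lconv x y : x < n -> y < n -> L y x = rconv (L x y).
  by move=> xn yn; apply: (net_conv net).
have Ltri x y z : x < n -> y < n -> z < n -> rtri (L x y) (L y z) (L z x).
  by move=> xn yn zn; apply: (net_tri net).
have [f fhom fP] : exists2 f, fr_hom f & L a d = inr White ->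
    forall c c' i i', c < n -> c' < n -> i != i' ->
    in_cone L a d c i -> in_cone L a d c' i' -> L c c' = inr (Red (f i) (f i')).
  have [/(cones _ _ an dn)[f fh fP]|nW] := EM (L a d = inr White); first by exists f.
  by have [f fh] := hom_exists; exists f.
pose red c : shade J := match al, L a c with
  | inl i, inl k => if i == k then Pink else Red (f i) (f k) | _, _ => Pink end.
(* White is the default. Black replaces it where the new point and [c] have green edges to a common
   endpoint, and pink or red replaces black where both points lie over [(a,d)]. The [Pink] default
   in [red] is never reached here. *)
pose lab c : ratom F :=
  if isg al && isg (L a c) then
    if isy be && isy (L d c) then inr (red c) else inr Black
  else if isg be && isg (L d c) then inr Black else inr White.
pose N c := if c == a then rconv al else if c == d then be else lab c.
have lab_soft c : soft (lab c).
  rewrite /lab; case: ifP => _; last by case: ifP.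
  by case: ifP => // _; rewrite /red; case: (al) (L a c) => [i|?] [k|?] //; case: ifP.
have dL x y : x < n -> y < n -> x != y -> div (L x y) by move=> *; rewrite /div Lid.
(* A green-green corner at [a] rules out a green-yellow corner at [d], which would reject black;
   [gyD] exchanges the two corners. *)
have gyA c : c < n -> isg al && isg (L a c) ->
    ~~ (isg be && isy (L d c)) && ~~ (isy be && isg (L d c)).
  move=> cn gg; have t1 : rtri (rconv be) (rconv al) (L a d).
    by rewrite (Lconv d a) // rtri_rot rtri_rot -rtri_conv.
  have t2 : rtri (rconv (L a d)) (L a c) (L c d) by rewrite -Lconv //; apply: Ltri.
  have := rtri_gy_gg t1 t2; rewrite !isg_conv isy_conv gg => /(_ isT).
  rewrite (Lconv d c) // isg_conv isy_conv andbC.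
  by rewrite ![_ && isy be]andbC ![_ && isg be]andbC.
have gyD c : c < n -> isg be && isg (L d c) ->
    ~~ (isg al && isy (L a c)) && ~~ (isy al && isg (L a c)).
  move=> cn gg; have t2 : rtri (rconv (L d a)) (L d c) (L c a).
    by rewrite -Lconv //; apply: Ltri.
  have := rtri_gy_gg tab t2; rewrite gg => /(_ isT).
  rewrite (Lconv a c) // isg_conv isy_conv andbC.
  by rewrite ![_ && isy al]andbC ![_ && isg al]andbC.
have labA c : c < n -> c != a -> c != d -> rtri (rconv al) (L a c) (rconv (lab c)).
  move=> cn ca cd; have dA : div (L a c) by apply: dL; rewrite // eq_sym.
  rewrite /lab; have [ggA|ngA] := boolP (isg al && isg (L a c)).
    case/andP: ggA => /isgP[i ali] /isgP[k ack].
    rewrite /red ali ack; case: ifP => _ /=; last by rewrite rtri_gg.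
    by have [->|ik] := eqVneq i k; rewrite rtri_gg ?eqxx //= fhom // eq_sym.
  have [ggD|ngD] := boolP (isg be && isg (L d c)); last first.
    by apply: rtri_white; rewrite ?div_conv ?isg_conv.
  have /andP[n1 n2] := gyD c cn ggD.
  apply: rtri_black; rewrite ?div_conv ?isg_conv ?isy_conv //.
  by move: nyg; case/andP: ggD => -> _; rewrite andbT => /negPf->.
have labD c : c < n -> c != a -> c != d -> rtri be (L d c) (rconv (lab c)).
  move=> cn ca cd; have dD : div (L d c) by apply: dL; rewrite // eq_sym.
  rewrite /lab; have [ggA|ngA] := boolP (isg al && isg (L a c)).
    have /andP[n1 n2] := gyA c cn ggA.
    have [yyD|nyD] := boolP (isy be && isy (L d c)); last exact: rtri_black.
    case/andP: yyD => /isyP-> /isyP->; case/andP: ggA => /isgP[i ali] /isgP[k ack].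
    by rewrite /red ali ack; case: ifP => _; rewrite rtri_yy.
  have [ggD|ngD] := boolP (isg be && isg (L d c)); last exact: rtri_white.
  case/andP: ggD => g1 g2.
  by apply: rtri_black; rewrite // ?(isg_isy g1) ?(isg_isy g2) ?andbF.
have lab_red c : c < n -> isr (lab c) -> exists i k,
    [/\ al = inl i, be = inr Yellow, in_cone L a d c k, i != k
      & lab c = inr (Red (f i) (f k))].
  move=> cn; rewrite /lab; case: ifP => [/andP[/isgP[i ali] /isgP[k ack]]|];
    last by case: ifP.
  case: ifP => // /andP[/isyP beY /isyP dcY]; rewrite /red ali ack.
  case: eqVneq => // ik _; exists i, k; split=> //.
  by split=> //; rewrite (Lconv d c) // dcY.
have Lad_white i : al = inl i -> be = inr Yellow -> L a d = inr White.
  move=> ali beY; have := tab; rewrite ali beY (Lconv d a) //.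
  have [->|dda] := eqVneq (L d a) (inr Id); first by rewrite rtri_Id3.
  by rewrite rtri_gy // => /eqP->.
(* Only an all red triangle could fail. Then [c] and [c'] both lie over [(a,d)], where [f] already
   gives the label of their edge; if their tints were equal, that edge could not be red. *)
have labC c c' : c < n -> c' < n -> c != c' ->
    rtri (lab c) (L c c') (rconv (lab c')).
  move=> cn c'n cc'.
  have [/and3P[r1 r2]|nr] :=
      boolP [&& isr (lab c), isr (L c c') & isr (rconv (lab c'))];
    last by apply: rtri_soft; rewrite ?soft_conv //; apply: dL.
  rewrite isr_conv => /(lab_red _ c'n)[i [k' [ali beY ck' _ ->]]].
  have [i' [k [ali' _ ck _ ->]]] := lab_red _ cn r1.
  have {i' ali'}-> : i' = i by move: ali'; rewrite ali => -[].
  have [ekk|kk'] := eqVneq k k'; last first.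
    by rewrite (fP (Lad_white _ ali beY) c c' k k') // rtri_div //= !eqxx.
  have := Ltri c a c' cn an c'n; rewrite (Lconv a c) // (Lconv c c') //.
  case: ck ck' => -> _ [-> _]; case: (L c c') r2 => [|[]] // j j' _ /=.
  by rewrite ekk rtri_gg // (negPf (fr_edge_irr _ _ _)).
have Na : N a = rconv al by rewrite /N eqxx.
have Nd : d != a -> N d = be by rewrite /N => /negPf->; rewrite eqxx.
have Nlab c : c != a -> c != d -> N c = lab c by rewrite /N => /negPf-> /negPf->.
(* Green and yellow edges at the new point lead only to [a] and [d], so at most these two lie over a
   new edge, as [cone_hom2] requires. *)
have Nsoft c : ~~ soft (N c) -> c = a \/ c = d.
  have [|ca] := eqVneq c a; first by left.
  by have [|cd] := eqVneq c d; [right|rewrite Nlab ?lab_soft].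
have net' : @network (rainbow F) n.+1 (@extend (rainbow F) n L N).
  apply: network_extend => // [c cn|c c' cn c'n cc'].
    have [->|ca] := eqVneq c a; first by rewrite Na; apply: etrans (div_conv al) dal.
    have [cd|cd] := eqVneq c d; first by rewrite cd Nd // -cd.
    by rewrite Nlab //; apply: soft_div.
  pose T c c' := rtri (N c) (L c c') (rconv (N c')).
  have Tsym p q : p < n -> q < n -> T p q -> T q p.
    by move=> pn qn; rewrite /T rtri_conv rconvK -Lconv.
  have Ta c0 : c0 < n -> c0 != a -> T a c0.
    move=> c0n c0a; rewrite /T Na; have [c0d|c0d] := eqVneq c0 d.
      rewrite c0d in c0a *; rewrite Nd // (Lconv d a) //.
      by rewrite rtri_rot -rtri_conv.
    by rewrite Nlab //; apply: labA.
  have Td c0 : c0 < n -> c0 != d -> T d c0.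
    move=> c0n c0d; have [da|da] := eqVneq d a.
      by rewrite da; apply: Ta; rewrite -?da.
    have [->|c0a] := eqVneq c0 a; first by apply: Tsym => //; apply: Ta.
    by rewrite /T Nd // Nlab //; apply: labD.
  change (T c c').
  have [ca|ca] := eqVneq c a; first by rewrite ca; apply: Ta; rewrite // -ca eq_sym.
  have [cd|cd] := eqVneq c d; first by rewrite cd; apply: Td; rewrite // -cd eq_sym.
  have [c'a|c'a] := eqVneq c' a; first by rewrite c'a; apply: Tsym => //; apply: Ta.
  have [c'd|c'd] := eqVneq c' d; first by rewrite c'd; apply: Tsym => //; apply: Td.
  by rewrite /T !Nlab //; apply: labC.
set L' := @extend (rainbow F) n L N in net' *.
have L'n y : y < n -> L' n y = N y by apply: (@extendn (rainbow F)).
have L'C x : x < n -> L' x n = rconv (N x) by apply: (@extendC (rainbow F)).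
have L'lt x y : x < n -> y < n -> L' x y = L x y by apply: (@extend_lt (rainbow F)).
have L'nn : L' n n = inr Id by apply: (@extendnn (rainbow F)).
have split x : x < n.+1 -> x = n \/ x < n.
  by rewrite ltnS leq_eqVlt => /orP[/eqP|]; [left|right].
exists L'; split=> //; last first.
  rewrite L'C // L'n // Na rconvK; split=> //.
  have [da|/Nd//] := eqVneq d a.
  move: tab; rewrite da Na (eqP (_ : L a a == inr Id)) ?Lid ?eqxx // rtri_Id3.
  by move=> /eqP->; rewrite rconvK.
split=> // x y /split[->|xn] /split[->|yn]; first by rewrite L'nn.
- move=> _; apply: (cone_hom2 net' (leqW an) (leqW dn) (ltnSn n) (leqW yn)).
  move=> c i /split[->|cn] [].
    by rewrite L'nn.
  by rewrite L'n // => Nc _; apply: Nsoft; rewrite Nc.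
- move=> _; apply: (cone_hom2 net' (leqW an) (leqW dn) (leqW xn) (ltnSn n)).
  move=> c i /split[->|cn] [_].
    by rewrite L'nn.
  by rewrite L'C // => Nc; apply: Nsoft; rewrite -soft_conv Nc.
rewrite L'lt // => xyW.
have coneL c i : c < n -> in_cone L' x y c i -> in_cone L x y c i.
  by move=> cn; rewrite /in_cone !L'lt.
(* An old white edge keeps its homomorphism unless the new point lies over it. *)
have [[i0 coned]|nocone] := EM (exists i, in_cone L' x y n i); last first.
  have [f0 f0hom f0P] := cones _ _ xn yn xyW; exists f0 => // c c' i i'.
  move=> /split[->|cn] /split[->|c'n] ii' ci ci'.
  - by case: nocone; exists i.
  - by case: nocone; exists i.
  - by case: nocone; exists i'.
  - rewrite L'lt //; apply: (f0P c c' i i' cn c'n ii').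
      exact: coneL cn ci.
    exact: coneL c'n ci'.
have [xa yd ali0 beY] : [/\ x = a, y = d, al = inl i0 & be = inr Yellow].
  case: (coned); rewrite L'C // L'n // => Nx Ny.
  have {}Nx : N x = inl i0 by rewrite -[N x]rconvK Nx.
  have [xa|xd] : x = a \/ x = d by apply: Nsoft; rewrite Nx.
    have ali : al = inl i0 by rewrite -[al]rconvK -Na -xa Nx.
    have [ya|yd] : y = a \/ y = d by apply: Nsoft; rewrite Ny.
      by move: Ny; rewrite ya -xa Nx.
    have da : d != a by apply/eqP=> da; move: Ny; rewrite yd da -xa Nx.
    by split=> //; rewrite -(Nd da) -yd Ny.
  have [da|da] := eqVneq d a.
    have ali : al = inl i0 by rewrite -[al]rconvK -Na -da -xd Nx.
    have [ya|yd] : y = a \/ y = d by apply: Nsoft; rewrite Ny.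
      by move: Ny; rewrite ya -da -xd Nx.
    by move: Ny; rewrite yd -xd Nx.
  have bei : be = inl i0 by rewrite -(Nd da) -xd Nx.
  have [ya|yd] : y = a \/ y = d by apply: Nsoft; rewrite Ny.
    by move: nyg; rewrite bei -[al]rconvK -Na -ya Ny.
  by move: Ny; rewrite yd -xd Nx.
have red_cone c i : c < n -> i0 != i -> in_cone L x y c i ->
    N c = inr (Red (f i0) (f i)).
  rewrite xa yd => cn i0i [aci cdY].
  have ca : c != a.
    by apply/eqP=> ca; move: aci; rewrite ca (eqP (_ : L a a == inr Id)) ?Lid.
  have cd : c != d.
    by apply/eqP=> cd; move: cdY; rewrite cd (eqP (_ : L d d == inr Id)) ?Lid.
  rewrite Nlab // /lab /red ali0 beY aci (Lconv c d) // cdY /=.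
  by rewrite (negPf i0i).
have tint_n i : in_cone L' x y n i -> i0 = i.
  by case: coned => e _ [e' _]; move: e; rewrite e' => -[].
exists f => // c c' i i' /split[->|cn] /split[->|c'n] ii' ci ci'.
- by rewrite -(tint_n _ ci) -(tint_n _ ci') eqxx in ii'.
- rewrite L'n // -(tint_n _ ci); apply: red_cone (coneL _ _ c'n ci') => //.
  by rewrite (tint_n _ ci).
- rewrite L'C // -(tint_n _ ci') (red_cone _ _ cn _ (coneL _ _ cn ci)) //.
  by rewrite (tint_n _ ci') eq_sym.
- rewrite L'lt //; apply: fP => //; first by rewrite -xa -yd.
    by rewrite -xa -yd; apply: coneL.
  by rewrite -xa -yd; apply: coneL.
Qed.

Lemma rainbow_representable :
  representable (complex_algebra (rainbow F) : relationAlgebraType _).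
Proof.
apply: (@representable_limit (rainbow F) rnetwork (fun _ _ => inr Id)).
- by move=> n L [].
- split=> //; split=> [x y|x y|x y z]; rewrite ?ltnS ?leqn0.
  + by move=> /eqP-> /eqP->; rewrite !eqxx.
  + by [].
  + by move=> *; apply: etrans (@rtri_id F _ _) _.
move=> n L [[[x y] al] be] n0 netL.
have [/and5P[xn yn dal dbe t]|invalid] :=
    boolP [&& x < n, y < n, al != inr Id, be != inr Id & rtri al be (L y x)];
  last first.
  (* A task that does not apply still uses up a stage: a point is added with a white edge to 0. *)
  have [|L' [netL' L'lt _]] :=
      @rnetwork_point n L 0 0 (inr White) (inr White) n0 n0 isT isT _ isT netL.
    by case: netL => net _; rewrite (eqP (_ : L 0 0 == inr Id)) ?(net_id net).
  exists L'; split=> // xn yn dal dbe.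
  rewrite L'lt // => t; case/negP: invalid; exact/and5P.
have conv_sym M : @network (rainbow F) n.+1 M -> M y n = rconv be -> M n x = rconv al ->
    M x n = al /\ M n y = be.
  move=> netM e1 e2; have Mconv := net_conv netM.
  rewrite (Mconv n x) ?ltnSn ?leqW // (Mconv y n) ?ltnSn ?leqW // e1 e2.
  by rewrite /= !rconvK.
have [/andP[/isyP alY /isgP[i bei]]|nyg] := boolP (isy al && isg be); last first.
  have [L' [netL' L'lt [e1 e2]]] := rnetwork_point xn yn dal dbe t nyg netL.
  by exists L'; split=> // *; exists n.
(* The case excluded by [rnetwork_point] is its mirror image, so the task is read from [y] to
   [x]. *)
have [||||L' [netL' L'lt [e1 e2]]] :=
  @rnetwork_point n L y x (rconv be) (rconv al) yn xn _ _ _ _ netL.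
- by rewrite div_conv.
- by rewrite div_conv.
- case: netL => net _; have -> : L x y = rconv (L y x) by apply: (net_conv net).
  by rewrite rtri_rot rtri_rot -rtri_conv.
- by rewrite alY bei.
exists L'; split=> // *; exists n => //; apply: conv_sym => //.
by case: netL'.
Qed.

End RainbowRepresentation.

(** * Extracting homomorphisms from a representation *)

Section Atoms.
Variables (A : atom_structure) (U : Type).
Variable h : complex_algebra A -> set (U * U).
Hypothesis rep : representation (h : (complex_algebra A : relationAlgebraType _) -> _).

Definition at_lab (a : A) x y := h [set a] (x, y).

(** The laws of a representation restated for finite sets; the operations of the complex algebra
    agree with these by conversion. *)
Let hU (X Y : {set A}) : h (X :|: Y) = (h X `|` h Y)%classic.
Proof. exact: (rep_join rep). Qed.

Let hI (X Y : {set A}) : h (X :&: Y) = (h X `&` h Y)%classic.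
Proof. exact: (rep_meet rep). Qed.

Let h0 : h set0 = classical_sets.set0.
Proof. exact: (rep_bot rep). Qed.

Let h_comp (X Y : {set A}) : h (cm_comp X Y) =
  [set xy | exists z, h X (xy.1, z) /\ h Y (z, xy.2)]%classic.
Proof. exact: (rep_comp rep). Qed.

Let h_conv (X : {set A}) : h (cm_conv X) = [set xy | h X (xy.2, xy.1)]%classic.
Proof. exact: (rep_conv rep). Qed.

Lemma rep_sub (X Y : {set A}) xy : X \subset Y -> h X xy -> h Y xy.
Proof.
by move/setUidPr=> <- hX; rewrite hU; left.
Qed.

(** Finiteness matters here: [X] is a finite join of atoms, and finite joins are preserved. *)
Lemma rep_atom (X : {set A}) x y : h X (x, y) -> exists2 a, a \in X & at_lab a x y.
Proof.
elim: {X}_.+1 {-2}X (ltnSn #|X|) => // n IH X leXn hX.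
have [X0|[a aX]] := set_0Vmem X.
  by move: hX; rewrite X0 h0.
move: hX; rewrite -(setD1K aX) hU => -[?|hX].
  by exists a => //; apply: setU11.
have [||b bX hb] := IH (X :\ a) => //; last by exists b; rewrite // setU1r.
by rewrite -ltnS (leq_trans _ leXn) // ltnS [in X in _ <= X](cardsD1 a) aX.
Qed.

Lemma lab_mem (X : {set A}) a x y : at_lab a x y -> h X (x, y) -> a \in X.
Proof.
move=> ha hX; apply: contraT => aX.
have : h ([set a] :&: X) (x, y) by rewrite hI.
have -> : [set a] :&: X = set0 by apply/eqP; rewrite setI_eq0 disjoints1.
by rewrite h0.
Qed.

Lemma lab_inj a b x y : at_lab a x y -> at_lab b x y -> a = b.
Proof. by move=> ha /(lab_mem ha) /set1P. Qed.

Lemma lab_conv a x y : at_lab a x y -> at_lab (at_conv a) y x.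
Proof.
rewrite /at_lab => ha; have -> : [set at_conv a] = cm_conv [set a].
  by apply/setP=> b; rewrite !inE -(inj_eq (can_inj (@at_convK A))) at_convK.
by rewrite h_conv.
Qed.

Lemma lab_tri a b c x y z : at_lab a x y -> at_lab b y z -> at_lab c z x ->
  at_tri a b c.
Proof.
move=> hab hbc /lab_conv hca.
have /(lab_mem hca) : h (cm_comp [set a] [set b]) (x, z).
  by rewrite h_comp; exists y.
by case/cm_compP=> a' [b' [/set1P-> /set1P->]]; rewrite at_convK.
Qed.

Lemma lab_witness a b c x z : at_tri a b c -> at_lab c z x ->
  exists y, at_lab a x y /\ at_lab b y z.
Proof.
move=> t /lab_conv hc; have : h (cm_comp [set a] [set b]) (x, z).
  apply: rep_sub hc; rewrite sub1set; apply/cm_compP; exists a, b.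
  by rewrite !set11 at_convK.
by rewrite h_comp => -[y ?]; exists y.
Qed.

Lemma lab_ex a : exists x y, at_lab a x y.
Proof.
apply: contrapT => none; have : [set a] = set0.
  apply: (rep_inj rep); rewrite [RHS]h0.
  by apply/funext=> -[x y]; apply/propext; split=> // ha; case: none; exists x, y.
by move/setP/(_ a); rewrite set11 in_set0.
Qed.

Lemma lab_total a b x y z : at_lab a x y -> at_lab b y z -> exists c, at_lab c x z.
Proof.
move=> ha hb; have : h setT (x, z).
  apply: (rep_unit_trans rep :
      forall x y z, h setT (x, y) -> h setT (y, z) -> h setT (x, z));
    [apply: rep_sub (subsetT _) ha | apply: rep_sub (subsetT _) hb].
by case/rep_atom=> c _; exists c.
Qed.

End Atoms.

(** * Representability forces partial homomorphisms of size two to extend *)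

Section NonRepresentable.
Variable F : frame.
Local Notation I := (fr_tint F).
Local Notation J := (fr_index F).

Lemma representable_rainbow_hom (i0 i1 : I) (j0 j1 : J) :
  representable (complex_algebra (rainbow F) : relationAlgebraType _) ->
  fr_edge i0 i1 j0 j1 ->
  exists2 f, @fr_hom F f & f i0 = j0 /\ f i1 = j1.
Proof.
case=> U [h rep] e01; set lab := @at_lab (rainbow F) U h.
have tri a b c x y z : lab a x y -> lab b y z -> lab c z x -> rtri a b c.
  exact: (lab_tri rep).
have witness a b c x z : rtri a b c -> lab c z x -> exists y, lab a x y /\ lab b y z.
  exact: (lab_witness rep).
have conv a x y : lab a x y -> lab (rconv a) y x by exact: (lab_conv rep).
have labI a b x y : lab a x y -> lab b x y -> a = b by exact: (lab_inj rep).
have [z1 [z0 z10]] : exists x y, lab (inr (Red j1 j0)) x y by exact: (lab_ex rep).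
have [x [xz0' xz1]] : exists x, lab (inl i0) z0 x /\ lab (inl i1) x z1.
  by apply: witness z10; rewrite rtri_gg // fr_edgeC.
have xz0 : lab (inl i0) x z0 := conv _ _ _ xz0'.
have [y [z0y z1y']] : exists y, lab (inr Yellow) z0 y /\ lab (inr Yellow) y z1.
  by apply: witness z10; rewrite rtri_yy.
have z1y : lab (inr Yellow) z1 y := conv _ _ _ z1y'.
have xy : lab (inr White) x y.
  have [c xyc] : exists c, lab c x y by exact: (lab_total rep xz0 z0y).
  have := tri _ _ _ _ _ _ xz0 z0y (conv _ _ _ xyc).
  have [e|dc] := eqVneq (rconv c) (inr Id); first by rewrite e rtri_Id3.
  by rewrite rtri_gy // rconv_eq => /eqP e; rewrite -[inr White]e.
(* The white edge [(x,y)] carries a point for every tint; [z0] and [z1] are kept for [i0] and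
   [i1]. *)
have /choice[z zP] (k : I) : exists u,
    [/\ lab (inl k) x u, lab (inr Yellow) u y, k = i0 -> u = z0
      & k = i1 -> u = z1].
  have i01 : i0 != i1.
    by apply/eqP=> e; move: e01; rewrite e (negPf (fr_edge_irr _ _ _)).
  have [->|k0] := eqVneq k i0.
    by exists z0; split=> // /eqP; rewrite (negPf i01).
  have [->|k1] := eqVneq k i1.
    by exists z1; split=> // /eqP; rewrite eq_sym (negPf i01).
  have [u [xu uy]] : exists u, lab (inl k) x u /\ lab (inr Yellow) u y.
    by apply: (witness _ _ _ _ _ _ (conv _ _ _ xy)); rewrite rtri_gy.
  by exists u; split=> // /eqP; rewrite ?(negPf k0) ?(negPf k1).
have zx k : lab (inl k) (z k) x by case: (zP k) => /conv.
have xz k : lab (inl k) x (z k) by case: (zP k).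
have zy k : lab (inr Yellow) (z k) y by case: (zP k).
have yz k : lab (inr Yellow) y (z k) by case: (zP k) => _ /conv.
have red k l : k != l -> exists p q, lab (inr (Red p q)) (z k) (z l) /\ fr_edge k l p q.
  move=> kl; have [c zc] : exists c, lab c (z k) (z l).
    exact: (lab_total rep (zx k) (xz l)).
  have t1 := tri _ _ _ _ _ _ (zx k) (xz l) (conv _ _ _ zc).
  have t2 := tri _ _ _ _ _ _ (zy k) (yz l) (conv _ _ _ zc).
  have [p [q [/(congr1 (@rconv F)) e epq]]] := rtri_cone kl t1 t2.
  by exists p, q; move: zc; rewrite -[c]rconvK e.
have zi0 : z i0 = z0 by case: (zP i0) => _ _ /(_ erefl).
have zi1 : z i1 = z1 by case: (zP i1) => _ _ _ /(_ erefl).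
have red_tri p q q' r s t k l m : lab (inr (Red p q)) (z k) (z l) ->
    lab (inr (Red q' r)) (z l) (z m) -> lab (inr (Red s t)) (z m) (z k) ->
    [/\ q = q', r = s & t = p].
  move=> kl lm mk; have := tri _ _ _ _ _ _ kl lm mk.
  by rewrite rtri_div //= => /and3P[/eqP-> /eqP-> /eqP->].
(* The red triangle through [z1] shows that all red edges leaving [z0] have first index [j0]; the
   second index is the value of [f]. *)
have /choice[f fP] (k : I) : exists j, (k = i0 -> j = j0) /\
    (k != i0 -> lab (inr (Red j0 j)) z0 (z k)).
  have [->|k0] := eqVneq k i0; first by exists j0.
  rewrite eq_sym in k0; have [p [q [zpq _]]] := red _ _ k0.
  exists q; split=> [e|_]; first by rewrite e eqxx in k0.
  rewrite -zi0; have [k1|k1] := eqVneq k i1.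
    move: (zpq); rewrite k1 zi0 zi1.
    by move=> /labI/(_ (conv _ _ _ z10)) [_ ->]; apply: conv z10.
  have [p' [q' [zpq' _]]] := red _ _ k1; rewrite -zi1 -zi0 in z10.
  by have [-> _ _] := red_tri _ _ _ _ _ _ _ _ _ z10 zpq zpq'.
have f0 : f i0 = j0 by case: (fP i0) => ->.
have fz k : k != i0 -> lab (inr (Red (f i0) (f k))) (z i0) (z k).
  by rewrite zi0 f0; case: (fP k).
exists f; last first.
  split=> //; have [e|i10] := eqVneq i1 i0.
    by move: e01; rewrite e (negPf (fr_edge_irr _ _ _)).
  move: (fz _ i10); rewrite zi0 zi1 => /labI /(_ (conv _ _ _ z10)).
  by case.
have edge0 l : l != i0 -> fr_edge i0 l (f i0) (f l).
  move=> l0; have l0' := l0; rewrite eq_sym in l0'.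
  by have [p [q [/labI/(_ (fz _ l0)) [-> ->]]]] := red _ _ l0'.
move=> k l kl; have [k0|k0] := eqVneq k i0.
  by rewrite k0; apply: edge0; rewrite -k0 eq_sym.
have [->|l0] := eqVneq l i0; first by rewrite fr_edgeC edge0.
(* Matching indices in the triangle with [z i0] identifies [p] and [q] with the values of [f]. *)
have [p [q [zpq epq]]] := red _ _ kl.
have [e1 _ e2] := red_tri _ _ _ _ _ _ _ _ _ zpq (conv _ _ _ (fz _ l0)) (fz _ k0).
by rewrite e2 -e1.
Qed.

End NonRepresentable.

(** * The frame of two binary structures *)

Section HomFrame.
Variables (S : Type) (G K : binary_structure S).

(** The signature is an arbitrary type, so the condition is made boolean classically. *)
Definition pair_edge (i i' : G) (j j' : K) : bool :=
  (i != i') && `[< forall b,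
     ((i, i') \in bs_interp G b -> (j, j') \in bs_interp K b) /\
     ((i', i) \in bs_interp G b -> (j', j) \in bs_interp K b) >].

Lemma pair_edgeC i i' j j' : pair_edge i i' j j' = pair_edge i' i j' j.
Proof.
rewrite /pair_edge eq_sym; congr (_ && _).
by apply: asbool_equiv_eq; split=> e b; have [] := e b.
Qed.

Lemma pair_edge_irr i j j' : ~~ pair_edge i i j j'.
Proof. by rewrite /pair_edge eqxx. Qed.

Lemma pair_edge_homP i i' j j' : i != i' ->
  pair_edge i i' j j' <-> partial_hom (pair_map i j i' j').
Proof.
move=> ii'; rewrite /pair_edge ii' /=; split=> [/asboolP e b x x' y y' xx'|ph].
  rewrite /pair_map; have [e1 e2] := e b.
  have [xi|xi] := eqVneq x i; [|have [xi1|//] := eqVneq x i'];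
    (have [x'i|x'i] := eqVneq x' i; [|have [x'i1|//] := eqVneq x' i']);
    subst; rewrite ?eqxx // in xx' => -[<-] [<-] //.
apply/asboolP=> b; split; apply: ph; rewrite /pair_map ?eqxx //.
- by rewrite eq_sym (negPf ii').
- by rewrite eq_sym.
- by rewrite eq_sym (negPf ii').
Qed.

Definition total_on := forall i i', i != i' -> exists j j', pair_edge i i' j j'.

Definition hom_frame (total : total_on) :=
  Frame pair_edgeC pair_edge_irr total.

Definition hom_algebra (total : total_on) : relationAlgebraType _ :=
  complex_algebra (rainbow (hom_frame total)).

Lemma fr_hom_homomorphism total f :
  @fr_hom (hom_frame total) f <-> @homomorphism S G K f.
Proof.
split=> [hf b i i' j j' ii' [<-] [<-]|hf i i' ii'].
  by have /andP[_ /asboolP e] := hf _ _ ii'; have [] := e b.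
apply/andP; split=> //; apply/asboolP=> b; split; first exact: hf.
by apply: hf; rewrite // eq_sym.
Qed.

End HomFrame.

(** * The colouring game *)

Section Game.
Variables (S : Type) (m : nat).

(* An invariant which the second player can maintain for ever. *)
Record safe (G H : binary_structure S) (W : position m G H -> Prop) : Prop := Safe {
  safe_pos : forall P, W P -> ~ forall_wins P;
  safe_inl : forall P t X, W P -> exists Y, W (recolour P.1 t X, recolour P.2 t Y);
  safe_inr : forall P t Y, W P -> exists X, W (recolour P.1 t X, recolour P.2 t Y)
}.

Definition swap (G H : binary_structure S) (P : position m G H) : position m H G :=
  (P.2, P.1).

(** The winning conditions are symmetric, so later arguments need only one direction. *)
Lemma safe_swap (G H : binary_structure S) (W : position m G H -> Prop) :
  safe W -> safe (fun P : position m H G => W (swap P)).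
Proof.
case=> pos inl inr; split=> [P /pos nW wins|P t X /inr|P t X /inl].
- apply: nW; case: wins => [[p]|[p [p' [b]]]]; rewrite eq_sym => wins; [left|right].
    by exists p.
  by exists p, p', b.
- by move=> /(_ t X).
- by move=> /(_ t X).
Qed.

Lemma eq_play (G H : binary_structure S) (s : strategy m G H) a a' n :
  (forall k, k < n -> a k = a' k) -> play s a n = play s a' n.
Proof.
elim: n => //= n IH aa'; rewrite IH => [|k kn]; last by rewrite aa' ?leqW.
rewrite aa' //; congr (next_position _ _ _ _); apply/eq_in_map => k.
by rewrite mem_iota add0n => /andP[_ kn]; rewrite aa' ?leqW.
Qed.

(** The positions reachable under a winning strategy are safe. *)
Lemma strategy_safe (G H : binary_structure S) (t0 : 'I_m) :
  exists_wins_colouring_game m G H ->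
  exists2 W : position m G H -> Prop, safe W & W (init_position m G H).
Proof.
case=> s win; exists (fun P => exists a n, P = play s a n); last first.
  by exists (fun=> (t0, inl set0)), 0.
have next a n (x : forall_move m G H) : exists a' n',
    next_position s (mkseq a n) x (play s a n) = play s a' n'.
  (* The play is redirected in round [n] only, so the position reached before it is unchanged. *)
  exists (fun k => if k == n then x else a k), n.+1; rewrite /= eqxx.
  rewrite (@eq_play _ _ s a (fun k => if k == n then x else a k)) => [|k kn].
    congr (next_position _ _ _ _); apply/eq_in_map => k.
    by rewrite mem_iota add0n => /andP[_ /ltn_eqF->].
  by rewrite ltn_eqF.
split=> [P [a [n ->]]|P t X [a [n ->]]|P t Y [a [n ->]]].
- exact: win.
- exists (reply_in_H s (mkseq a n) t X); exact: next a n (t, inl X).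
- exists (reply_in_G s (mkseq a n) t Y); exact: next a n (t, inr Y).
Qed.

(** * Colours holding a single point *)

Section Pebbles.
Variables (G H : binary_structure S) (W : position m G H -> Prop).
Hypothesis safeW : safe W.

Definition pebble (P : position m G H) t i i' := P.1 t = [set i] /\ P.2 t = [set i'].

Lemma safe_palette P p : W P ->
  (palette_set P.1 p == set0) = (palette_set P.2 p == set0).
Proof.
move=> WP; apply: contrapT => /eqP ne; apply: (safe_pos safeW WP); left.
by exists p.
Qed.

Lemma safe_palette2 P p p' b : W P ->
  (setX (palette_set P.1 p) (palette_set P.1 p') :&: bs_interp G b == set0) =
  (setX (palette_set P.2 p) (palette_set P.2 p') :&: bs_interp H b == set0).
Proof.
move=> WP; apply: contrapT => /eqP ne; apply: (safe_pos safeW WP); right.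
by exists p, p', b.
Qed.

Definition palette_of (T : finType) (g : colouring m T) x := [set t | x \in g t].

Lemma palette_ofP (T : finType) (g : colouring m T) x p :
  reflect (palette_of g x = p) (x \in palette_set g p).
Proof.
rewrite inE; apply: (iffP forallP) => [e|<- t]; last by rewrite inE.
by apply/setP=> t; rewrite inE (eqP (e t)).
Qed.

Lemma safe_palette_ex P i : W P -> exists i', palette_of P.2 i' = palette_of P.1 i.
Proof.
move=> WP.
have /set0Pn[i' /palette_ofP e] : palette_set P.2 (palette_of P.1 i) != set0.
  rewrite -safe_palette //; apply/set0Pn; exists i; exact/palette_ofP.
by exists i'.
Qed.

Lemma safe_palette_ex_r P i' : W P -> exists i, palette_of P.1 i = palette_of P.2 i'.
Proof.
move=> WP.
have /set0Pn[i /palette_ofP e] : palette_set P.1 (palette_of P.2 i') != set0.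
  rewrite safe_palette //; apply/set0Pn; exists i'; exact/palette_ofP.
by exists i.
Qed.

(** Some point of [H] has the palette of [i]. That palette contains [t], and only [i'] has the
    colour [t] in [H]. *)
Lemma pebble_palette P t i i' : W P -> pebble P t i i' ->
  palette_of P.1 i = palette_of P.2 i'.
Proof.
move=> WP [e1 e2]; have [k ek] := safe_palette_ex i WP.
suff -> : i' = k by rewrite ek.
have : t \in palette_of P.1 i by rewrite inE e1 set11.
by rewrite -ek inE e2 => /set1P.
Qed.

Lemma pebble_palette_set P t i i' : pebble P t i i' ->
  palette_set P.1 (palette_of P.1 i) = [set i] /\
  palette_set P.2 (palette_of P.2 i') = [set i'].
Proof.
move=> [e1 e2]; split; apply/setP=> x; apply/palette_ofP/set1P => [e|-> //].
  have : t \in palette_of P.1 x by rewrite e inE e1 set11.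
  by rewrite inE e1 => /set1P.
have : t \in palette_of P.2 x by rewrite e inE e2 set11.
by rewrite inE e2 => /set1P.
Qed.

Lemma pebble_mem P t i i' s : W P -> pebble P t i i' -> (i \in P.1 s) = (i' \in P.2 s).
Proof. by move=> WP /(pebble_palette WP)/setP/(_ s); rewrite !inE. Qed.

Lemma pebble_eq P t s i i' k k' : W P -> pebble P t i i' -> pebble P s k k' ->
  (i == k) = (i' == k').
Proof. by move=> WP pi [e1 e2]; have := pebble_mem s WP pi; rewrite e1 e2 !inE. Qed.

(** The palette sets of pebbled points are singletons, so (C2) compares one pair on each side. *)
Lemma pebble_interp P t s i i' k k' b : W P -> pebble P t i i' -> pebble P s k k' ->
  ((i, k) \in bs_interp G b) = ((i', k') \in bs_interp H b).
Proof.
move=> WP pi pk; have := safe_palette2 (palette_of P.1 i) (palette_of P.1 k) b WP.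
rewrite [in RHS](pebble_palette WP pi) [in RHS](pebble_palette WP pk).
have [-> ->] := pebble_palette_set pi; have [-> ->] := pebble_palette_set pk.
have X1 (T T' : finType) (x : T) (y : T') B :
    (setX [set x] [set y] :&: B == set0) = ((x, y) \notin B).
  rewrite (_ : setX _ _ = [set (x, y)]) ?setI_eq0 ?disjoints1 //.
  by apply/setP=> -[x' y']; rewrite in_setX !inE xpair_eqE.
by rewrite !X1 => /(congr1 negb); rewrite !negbK.
Qed.

(* The reply to [set i] must be a singleton, since the first player could
   otherwise single out one of its points with the colour q. *)
Lemma place_pebble P t q i : t != q -> W P ->
  exists i', W (recolour P.1 t [set i], recolour P.2 t [set i']).
Proof.
move=> tq WP; have [Y WY] := safe_inl safeW t [set i] WP.
suff [i' Yi'] : exists i', Y = [set i'] by exists i'; rewrite -Yi'.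
have [i' ei] := safe_palette_ex i WY.
have i'Y : i' \in Y.
  have : t \in palette_of (recolour P.1 t [set i]) i by rewrite inE ffunE eqxx set11.
  by rewrite -ei inE ffunE eqxx.
exists i'; apply/eqP; rewrite eqEsubset sub1set i'Y andbT; apply/subsetP=> y yY.
have [X WX] := safe_inr safeW q [set i'] WY; rewrite /= in WX.
have i_like z : z \in Y -> (i \in X) = (z == i').
  move=> zY; have [k ek] := safe_palette_ex_r z WX.
  have ki : k = i.
    have := congr1 (fun p : {set 'I_m} => t \in p) ek.
    by rewrite !inE !ffunE (negPf tq) !eqxx zY => /set1P.
  have := congr1 (fun p : {set 'I_m} => q \in p) ek.
  by rewrite ki !inE !ffunE !eqxx inE.
by rewrite inE -(i_like _ yY) (i_like _ i'Y).
Qed.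

End Pebbles.
End Game.

(** * Preservation of formulas *)

Section Similarity.
Variables (S : Type) (c m : nat) (K G H : binary_structure S).
Variables (totG : total_on G K) (totH : total_on H K).
Variables (v : 'I_c -> 'I_m) (p0 p1 : 'I_m).
Hypothesis v_inj : injective v.
Hypothesis p01 : p0 != p1.
Hypothesis v0 : forall k, v k != p0.
Hypothesis v1 : forall k, v k != p1.
Variable W : position m G H -> Prop.
Hypothesis safeW : safe W.

Local Notation AG := (hom_frame totG).
Local Notation AH := (hom_frame totH).
Implicit Types (P Q : position m G H) (t s : 'I_m).

(** Only green atoms need a pebble, as the two algebras have the same other atoms. *)
Definition matched Q t (a : ratom AG) (a' : ratom AH) : Prop :=
  match a, a' with
  | inl i, inl i' => pebble Q t i i'
  | inr r, inr r' => r = r'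
  | _, _ => False
  end.

Lemma matched_eq Q t s a a' b b' : W Q -> matched Q t a a' -> matched Q s b b' ->
  (a == b) = (a' == b').
Proof.
move=> WQ; case: a a' => [i|r] [i'|r'] //=; case: b b' => [k|u] [k'|u'] //=.
  by move=> pi pk; apply: (pebble_eq safeW WQ pi pk).
by move=> -> ->.
Qed.

Lemma matched_conv Q t a a' : matched Q t a a' -> matched Q t (rconv a) (rconv a').
Proof. by case: a a' => [i|r] [i'|r'] //= ->; case: r'. Qed.

Lemma matched_edge Q t s i i' k k' j j' : W Q -> pebble Q t i i' -> pebble Q s k k' ->
  fr_edge (f := AG) i k j j' = fr_edge (f := AH) i' k' j j'.
Proof.
move=> WQ pi pk; rewrite /= /pair_edge (pebble_eq safeW WQ pi pk); congr (_ && _).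
apply: asbool_equiv_eq; split=> e b; have := e b;
  by rewrite (pebble_interp safeW b WQ pi pk) (pebble_interp safeW b WQ pk pi).
Qed.

(** Triangles see tints only through equality and [fr_edge], both of which pebbles preserve. *)
Lemma matched_tri Q t1 t2 t3 a a' b b' d d' : W Q ->
  matched Q t1 a a' -> matched Q t2 b b' -> matched Q t3 d d' ->
  rtri a b d = rtri a' b' d'.
Proof.
move=> WQ; have id_check t4 t5 t6 x x' y y' z z' : matched Q t4 x x' ->
    matched Q t5 y y' -> matched Q t6 z z' -> rid_check x y z = rid_check x' y' z'.
  move=> mx my mz; rewrite /rid_check.
  rewrite (matched_eq (s := t4) (b := inr Id) (b' := inr Id) WQ mx) //.
  by rewrite (matched_eq WQ my (matched_conv mz)).
have check t4 t5 t6 x x' y y' z z' : matched Q t4 x x' ->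
    matched Q t5 y y' -> matched Q t6 z z' -> rcheck x y z = rcheck x' y' z'.
  case: x x' => [i|r] [i'|r'] //= mx; case: y y' => [k|u] [k'|u'] //= my;
    case: z z' => [l|w] [l'|w'] //= mz.
  - rewrite mz; case: w' {mz} => //= [|j j'].
      exact: (pebble_eq safeW WQ mx my).
    exact: matched_edge WQ my mx.
  - by rewrite my.
  - by rewrite my mz.
  - by rewrite mx.
  - by rewrite mx mz.
  - by rewrite mx my.
  - by rewrite mx my mz.
move=> ma mb md; rewrite /rtri (id_check _ _ _ _ _ _ _ _ _ ma mb md).
rewrite (id_check _ _ _ _ _ _ _ _ _ mb md ma) (id_check _ _ _ _ _ _ _ _ _ md ma mb).
rewrite (check _ _ _ _ _ _ _ _ _ ma mb md).
by rewrite (check _ _ _ _ _ _ _ _ _ mb md ma) (check _ _ _ _ _ _ _ _ _ md ma mb).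
Qed.

Definition same_vars P Q := forall k, P.1 (v k) = Q.1 (v k) /\ P.2 (v k) = Q.2 (v k).

Definition pebble_colour t := (t == p0) || (t == p1).

(* The values of a term need not be definable by colours; only the membership
   of single, pebbled, atoms in them is compared. *)
Definition similar P (X : {set ratom AG}) (X' : {set ratom AH}) :=
  forall Q t a a', W Q -> same_vars P Q -> pebble_colour t ->
  matched Q t a a' -> (a \in X) = (a' \in X').

(** The other pebble colour is the spare one with which [place_pebble] tests the reply; its contents
    are kept in the new position. *)
Lemma place_atom Q t a : W Q -> pebble_colour t ->
  exists R a', [/\ W R, matched R t a a', same_vars Q R
    & forall s, s != t -> Q.1 s = R.1 s /\ Q.2 s = R.2 s].
Proof.
move=> WQ pt; case: a => [i|r]; last by exists Q, (inr r).
have [i' WR] : exists i', W (recolour Q.1 t [set i], recolour Q.2 t [set i']).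
  case/orP: pt => /eqP->; first by apply: (place_pebble safeW i p01 WQ).
  have p10 : p1 != p0 by rewrite eq_sym.
  exact: (place_pebble safeW i p10 WQ).
exists (recolour Q.1 t [set i], recolour Q.2 t [set i']), (inl i'); split=> //.
- by split; rewrite ffunE eqxx.
- move=> k; rewrite !ffunE.
  by case/orP: pt => /eqP->; rewrite ?(negPf (v0 k)) ?(negPf (v1 k)).
- by move=> s /negPf st; rewrite !ffunE st.
Qed.

Lemma matched_other Q (R : position m G H) t s a a' : s != t ->
  (forall s, s != t -> Q.1 s = R.1 s /\ Q.2 s = R.2 s) ->
  matched Q s a a' -> matched R s a a'.
Proof.
move=> st QR; case: a a' => [i|r] [i'|r'] //=.
by case: (QR s st) => e1 e2; rewrite /pebble e1 e2.
Qed.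

Lemma same_vars_trans P Q (R : position m G H) :
  same_vars P Q -> same_vars Q R -> same_vars P R.
Proof. by move=> PQ QR k; case: (PQ k) (QR k) => -> -> [-> ->]. Qed.

(** If [d] is not green, both pebbles are free for [a] and [b]. If it is green, at most one of [a]
    and [b] is, because no triangle is entirely green, and the other pebble suffices. *)
Lemma similar_comp_half P X X' Y Y' Q t d d' : similar P X X' -> similar P Y Y' ->
  W Q -> same_vars P Q -> pebble_colour t -> matched Q t d d' ->
  d \in @cm_comp (rainbow AG) X Y -> d' \in @cm_comp (rainbow AH) X' Y'.
Proof.
move=> sX sY WQ PQ pt md /cm_compP[a [b [aX bY tri]]].
have goal (R : position m G H) s1 s2 s3 a' b' :
    W R -> same_vars P R -> pebble_colour s1 ->
    pebble_colour s2 -> matched R s1 a a' -> matched R s2 b b' -> matched R s3 d d' ->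
    d' \in @cm_comp (rainbow AH) X' Y'.
  move=> WR PR ps1 ps2 ma mb md'; apply/cm_compP; exists a', b'; split.
  - by rewrite -(sX _ _ _ _ WR PR ps1 ma).
  - by rewrite -(sY _ _ _ _ WR PR ps2 mb).
  - by move: tri; apply: etrans (esym (matched_tri WR ma mb (matched_conv md'))).
case: d md tri goal => [i|r] md tri goal; last first.
  have pc0 : pebble_colour p0 by rewrite /pebble_colour eqxx.
  have pc1 : pebble_colour p1 by rewrite /pebble_colour eqxx orbT.
  have [R [a' [WR ma QR _]]] := place_atom a WQ pc0.
  have [R' [b' [WR' mb RR' other]]] := place_atom b WR pc1.
  apply: (goal R' p0 p1 p0 a' b') => //.
    by apply: same_vars_trans RR'; apply: same_vars_trans QR.
  exact: matched_other other ma.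
(* The pebble colour not occupied by [d]. *)
pose u := if t == p0 then p1 else p0.
have tu : t != u.
  by rewrite /u; case: (eqVneq t p0) => [->|].
have pu : pebble_colour u by rewrite /u /pebble_colour; case: ifP; rewrite eqxx ?orbT.
case: a b aX bY tri goal => [k|r1] [l|r2] aX bY tri goal.
- by have := tri : rtri _ _ _; rewrite /= rtri_ggg.
- have [R [a' [WR ma QR other]]] := place_atom (inl k) WQ pu.
  apply: (goal R u u t a' (inr r2)) => //; first exact: same_vars_trans QR.
  exact: matched_other other md.
- have [R [b' [WR mb QR other]]] := place_atom (inl l) WQ pu.
  apply: (goal R u u t (inr r1) b') => //; first exact: same_vars_trans QR.
  exact: matched_other other md.
- exact: (goal Q t t t (inr r1) (inr r2)).
Qed.

Lemma similar_eq_half P X X' Y Y' : W P -> similar P X X' -> similar P Y Y' ->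
  X' = Y' -> X = Y.
Proof.
move=> WP sX sY eXY; apply/setP=> a.
have pc0 : pebble_colour p0 by rewrite /pebble_colour eqxx.
have [R [a' [WR ma PR _]]] := place_atom a WP pc0.
by rewrite (sX _ _ _ _ WR PR pc0 ma) (sY _ _ _ _ WR PR pc0 ma) eXY.
Qed.

(** Stronger than similarity: the value of a variable, unlike that of a term, has its green part
    stored in a colour. *)
Definition agree_at P k (X : {set ratom AG}) (X' : {set ratom AH}) :=
  [/\ forall r, (inr r \in X) = (inr r \in X'), P.1 (v k) = [set i | inl i \in X]
    & P.2 (v k) = [set i | inl i \in X']].

Lemma agree_similar P k X X' : agree_at P k X X' -> similar P X X'.
Proof.
move=> [Xr XG XH] Q t [i|r] [i'|r'] WQ PQ _ //= mt; last by rewrite mt Xr.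
have := pebble_mem safeW (v k) WQ mt; case: (PQ k) => <- <-.
by rewrite XG XH !inE.
Qed.

Lemma agree_move P k X : W P -> exists P' X', [/\ W P', agree_at P' k X X'
   & forall l, l != k -> P.1 (v l) = P'.1 (v l) /\ P.2 (v l) = P'.2 (v l)].
Proof.
move=> WP; have [Y WY] := safe_inl safeW (v k) [set i | inl i \in X] WP.
exists (recolour P.1 (v k) [set i | inl i \in X], recolour P.2 (v k) Y).
exists [set a | match a with inl i => i \in Y | inr r => inr r \in X end].
split=> //; first split=> [r||].
- by rewrite inE.
- by rewrite ffunE eqxx.
- by rewrite ffunE eqxx; apply/setP=> i; rewrite !inE.
- by move=> l lk; rewrite !ffunE (inj_eq v_inj) (negPf lk).
Qed.

End Similarity.

(** * Transfer of formulas between the two algebras *)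

Section Transfer.
Variables (S : Type) (c m : nat) (K : binary_structure S).
Variables (v : 'I_c -> 'I_m) (p0 p1 : 'I_m).
Hypothesis v_inj : injective v.
Hypothesis p01 : p0 != p1.
Hypothesis v0 : forall k, v k != p0.
Hypothesis v1 : forall k, v k != p1.

Section Swap.
Variables G H : binary_structure S.
Variables (totG : total_on G K) (totH : total_on H K).
Variable W : position m G H -> Prop.

Definition swapW (P : position m H G) := W (swap P).

Lemma matched_swap (Q : position m G H) t a a' :
  matched (totG := totG) (totH := totH) Q t a a' <->
  matched (totG := totH) (totH := totG) (swap Q) t a' a.
Proof. by case: a a' => [i|r] [i'|r'] //=; split=> -[]. Qed.

Lemma similar_swap (P : position m G H) X X' :
  similar (totG := totG) (totH := totH) v p0 p1 W P X X' ->
  similar (totG := totH) (totH := totG) v p0 p1 swapW (swap P) X' X.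
Proof.
move=> sX Q t a a' WQ PQ pt ma; symmetry.
apply: (sX (swap Q) t a' a WQ) => //; last exact/matched_swap.
by move=> k; case: (PQ k).
Qed.

Lemma agree_at_swap (P : position m G H) k X X' :
  agree_at (totG := totG) (totH := totH) v P k X X' ->
  agree_at (totG := totH) (totH := totG) v (swap P) k X' X.
Proof. by case=> Xr XG XH; split=> // r; rewrite Xr. Qed.

End Swap.

Section Formulas.
Variables G H : binary_structure S.
Variables (totG : total_on G K) (totH : total_on H K).
Variable W : position m G H -> Prop.
Hypothesis safeW : safe W.

Local Notation AG := (hom_algebra totG).
Local Notation AH := (hom_algebra totH).
Local Notation sim := (similar (totG := totG) (totH := totH) v p0 p1 W).
Local Notation agree := (agree_at (totG := totG) (totH := totH) v).

Lemma similar_comp P X X' Y Y' : sim P X X' -> sim P Y Y' ->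
  sim P (@cm_comp (rainbow (hom_frame totG)) X Y)
        (@cm_comp (rainbow (hom_frame totH)) X' Y').
Proof.
move=> sX sY Q t d d' WQ PQ pt md; apply/idP/idP.
  exact: (similar_comp_half p01 v0 v1 safeW sX sY WQ PQ pt md).
have WQ' : swapW W (swap Q) by case: Q WQ {PQ md}.
have PQ' : same_vars v (swap P) (swap Q) by move=> k; case: (PQ k).
have md' : matched (totG := totH) (totH := totG) (swap Q) t d' d by exact/matched_swap.
exact: (similar_comp_half p01 v0 v1 (safe_swap safeW) (similar_swap sX)
  (similar_swap sY) WQ' PQ' pt md').
Qed.

Lemma similar_eval P (e : 'I_c -> AG) (e' : 'I_c -> AH) :
  (forall k, sim P (e k) (e' k)) -> forall u, sim P (eval e u) (eval e' u).
Proof.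
move=> see; elim=> [k|u su w sw|u su w sw|u su|||u su w sw|u su|] /=.
- exact: see.
- move=> Q t a a' WQ PQ pt ma; apply: etrans (in_setU _ _ _) _.
  by rewrite (su _ _ _ _ WQ PQ pt ma) (sw _ _ _ _ WQ PQ pt ma);
    apply: esym (in_setU _ _ _).
- move=> Q t a a' WQ PQ pt ma; apply: etrans (in_setI _ _ _) _.
  by rewrite (su _ _ _ _ WQ PQ pt ma) (sw _ _ _ _ WQ PQ pt ma);
    apply: esym (in_setI _ _ _).
- move=> Q t a a' WQ PQ pt ma; apply: etrans (in_setC _ _) _.
  by rewrite (su _ _ _ _ WQ PQ pt ma); apply: esym (in_setC _ _).
- by move=> Q t a a' *; apply: etrans (in_set0 _) (esym (in_set0 _)).
- by move=> Q t a a' *; apply: etrans (in_setT _) (esym (in_setT _)).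
- exact: similar_comp.
- move=> Q t a a' WQ PQ pt ma; rewrite !in_set.
  exact: su WQ PQ pt (matched_conv ma).
- move=> Q t a a' WQ PQ pt ma; rewrite !in_set1.
  exact: (matched_eq (s := t) (b := inr Id) (b' := inr Id) safeW WQ ma).
Qed.

Lemma agree_move_r P k X' : W P -> exists P' X, [/\ W P', agree P' k X X'
   & forall l, l != k -> P.1 (v l) = P'.1 (v l) /\ P.2 (v l) = P'.2 (v l)].
Proof.
move=> WP; have WsP : swapW W (swap P) by case: P WP.
have [P' [X [WP' aP PP]]] := agree_move totG v_inj (safe_swap safeW) k X' WsP.
exists (swap P'), X; split=> // [|l /PP[]//].
exact: agree_at_swap aP.
Qed.

Lemma agree_update P P' k (e : 'I_c -> AG) (e' : 'I_c -> AH) X X' (D : pred 'I_c) :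
  (forall l, l \in D -> agree P l (e l) (e' l)) -> agree P' k X X' ->
  (forall l, l != k -> P.1 (v l) = P'.1 (v l) /\ P.2 (v l) = P'.2 (v l)) ->
  forall l, (l == k) || (l \in D) -> agree P' l (update e k X l) (update e' k X' l).
Proof.
move=> aD ak PP l; rewrite /update; have [-> //|lk] := eqVneq l k.
by move=> /= /aD; case: (PP l lk) => e1 e2; rewrite /agree_at e1 e2.
Qed.

(** Choosing a value for variable [k] is a move in the colour [v k], made on either side; the reply
    gives the green part of the corresponding value. *)
Lemma holds_transfer (F : ra_formula c) P (e : assignment c AG) (e' : assignment c AH) :
  W P -> (forall k, agree P k (e k) (e' k)) -> holds e F <-> holds e' F.
Proof.
elim: F P e e' => [u w||F IH|F IH F' IH'|F IH F' IH'|F IH F' IH'|k F IH|k F IH]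
  P e e' WP ag /=.
- have simeval x : sim P (eval e x) (eval e' x).
    by apply: similar_eval => // k; apply: agree_similar (ag k).
  split; last exact: (similar_eq_half p01 v0 v1 safeW WP (simeval u) (simeval w)).
  have WsP : swapW W (swap P) by case: P WP {ag simeval}.
  exact: (similar_eq_half p01 v0 v1 (safe_swap safeW) WsP
    (similar_swap (simeval u)) (similar_swap (simeval w))).
- by [].
- by have [h1 h2] := IH _ _ _ WP ag; split=> nF /= hF; apply: nF; [apply: h2|apply: h1].
- by have [h1 h2] := IH _ _ _ WP ag; have [h3 h4] := IH' _ _ _ WP ag; tauto.
- by have [h1 h2] := IH _ _ _ WP ag; have [h3 h4] := IH' _ _ _ WP ag; tauto.
- by have [h1 h2] := IH _ _ _ WP ag; have [h3 h4] := IH' _ _ _ WP ag; tauto.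
- split=> hF X.
    have [P' [Y [WP' aP PP]]] := agree_move_r k X WP.
    apply: (proj1 (IH P' (update e k Y) _ WP' _)) (hF Y) => l.
    by apply: (agree_update (D := predT) _ aP PP); rewrite ?orbT.
  have [P' [Y [WP' aP PP]]] := agree_move totH v_inj safeW k X WP.
  apply: (proj2 (IH P' _ (update e' k Y) WP' _)) (hF Y) => l.
  by apply: (agree_update (D := predT) _ aP PP); rewrite ?orbT.
- split=> -[X hF].
    have [P' [Y [WP' aP PP]]] := agree_move totH v_inj safeW k X WP.
    exists Y; apply: (proj1 (IH P' _ (update e' k Y) WP' _)) hF => l.
    by apply: (agree_update (D := predT) _ aP PP); rewrite ?orbT.
  have [P' [Y [WP' aP PP]]] := agree_move_r k X WP.
  exists Y; apply: (proj2 (IH P' (update e k Y) _ WP' _)) hF => l.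
  by apply: (agree_update (D := predT) _ aP PP); rewrite ?orbT.
Qed.

Lemma models_transfer (Th : theory c) P : W P -> models AH Th -> models AG Th.
Proof.
move=> WP mod F ThF e.
(* An arbitrary assignment is first copied to the other algebra, one variable at a time. *)
have [Q [e' [WQ ag]]] : exists Q (e' : assignment c AH), W Q /\
    forall k, k \in enum 'I_c -> agree Q k (e k) (e' k).
  elim: (enum 'I_c) => [|k ks [Q [e' [WQ ag]]]]; first by exists P, (fun=> set0).
  have [Q' [Y [WQ' aQ QQ]]] := agree_move totH v_inj safeW k (e k) WQ.
  exists Q', (update e' k Y); split=> // l; rewrite inE => lk.
  have := agree_update (D := mem ks) ag aQ QQ lk.
  by rewrite {1}/update; case: eqP => [->|].
apply: (proj2 (holds_transfer F WQ _)) (mod F ThF e') => k.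
by apply: ag; rewrite mem_enum.
Qed.

End Formulas.
End Transfer.

(** * Totality of the frames, and the conclusion *)

Lemma safe_total_on (S : Type) (m : nat) (G H : binary_structure S)
    (W : position m G H -> Prop) P (p0 p1 : 'I_m) :
  safe W -> W P -> p0 != p1 -> total_on G H.
Proof.
move=> safeW WP p01 i i' ii'.
have p10 : p1 != p0 by rewrite eq_sym.
(* Pebbles are put on [i] and [i']; the two replies serve as [j] and [j']. *)
have [j WQ] := place_pebble safeW i p01 WP.
have [j' WR] := place_pebble safeW i' p10 WQ.
set R := (X in W X) in WR.
have pi : pebble R p0 i j by split; rewrite !ffunE (negPf p01) eqxx.
have pi' : pebble R p1 i' j' by split; rewrite !ffunE eqxx.
exists j, j'; rewrite /pair_edge ii'; apply/asboolP=> b.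
by rewrite (pebble_interp safeW b WR pi pi') (pebble_interp safeW b WR pi' pi).
Qed.

Lemma total_on_refl (S : Type) (H : binary_structure S) : total_on H H.
Proof.
by move=> i i' ii'; exists i, i'; rewrite /pair_edge ii'; apply/asboolP.
Qed.

Theorem theorem4p4 (c : nat) (S : Type) (G H : binary_structure S)
  (hgame : exists_wins_colouring_game (c + 3) G H)
  (hHH : forall h : H -> option H,
     partial_hom h -> #|pdom h| = 2 -> extends_to_hom h)
  (hGH : exists (i i' : G) (j j' : H),
     [/\ i != i', partial_hom (pair_map i j i' j')
       & ~ extends_to_hom (pair_map i j i' j')]) :
  ~ exists Th : theory c, theory_of_sentences Th /\ defines_RRA Th.
Proof.
(* The first [c] colours hold the variables, and [p0] and [p1] are the pebbles. *)
pose v (k : 'I_c) : 'I_(c + 3) := lshift 3 k.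
pose p0 : 'I_(c + 3) := rshift c ord0.
pose p1 : 'I_(c + 3) := rshift c ord_max.
have p01 : p0 != p1 by rewrite (inj_eq (@rshift_inj _ _)).
have v_inj : injective v := @lshift_inj _ _.
have v0 k : v k != p0 by rewrite eq_lrshift.
have v1 k : v k != p1 by rewrite eq_lrshift.
have [W safeW W0] := strategy_safe p0 hgame.
have totG := safe_total_on safeW W0 p01.
have totH := @total_on_refl _ H.
case=> Th [_ defRRA].
have repH : representable (hom_algebra totH).
  apply: rainbow_representable => [|i i' j j' e].
    by exists id; apply/fr_hom_homomorphism => b i i' j j' _ [<-] [<-].
  have ii' : i != i' by case/andP: e.
  have ph := proj1 (pair_edge_homP j j' ii') e.
  have [|f fhom fP] := hHH _ ph.
    rewrite (_ : pdom _ = [set i; i']) ?cards2 ?ii' //.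
    by apply/setP=> x; rewrite !inE /pair_map; case: (x == i); case: (x == i').
  exists f; first exact/fr_hom_homomorphism.
  by split; apply: fP; rewrite /pair_map ?eqxx // eq_sym (negPf ii').
(* The theory holds in A(H,H), hence in A(G,H), which would then be representable, against (3). *)
have repG : representable (hom_algebra totG).
  apply: (proj2 (defRRA _ _)).
  exact: (models_transfer v_inj p01 v0 v1 safeW W0 (proj1 (defRRA _ _) repH)).
have [i [i' [j [j' [ii' ph noext]]]]] := hGH; apply: noext.
have [f fhom [fi fi']] :=
  representable_rainbow_hom repG (proj2 (pair_edge_homP j j' ii') ph).
exists f; first exact/fr_hom_homomorphism.
move=> x y; rewrite /pair_map; have [->|_] := eqVneq x i; first by case=> <-.
by have [->|//] := eqVneq x i'; case=> <-.
Qed.
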